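(* Let $S^{(j)}=\begin{pmatrix}a_j&b_j\\c_j&d_j\end{pmatrix}\in\operatorname{Sp}(2,\mathbb{R})$, $j=1,2$, be such that $a_1b_2-a_2b_1\ne0$, and let $\widehat{S^{(1)}},\widehat{S^{(2)}}$ be metaplectic operators projecting onto $S^{(1)},S^{(2)}$. Let $f:\mathbb{R}\to\mathbb{C}$, $f\in L^2(\mathbb{R})$, satisfy $$|(\widehat{S^{(1)}}f)(x)|\le C_1e^{-\alpha x^2},\qquad |(\widehat{S^{(2)}}f)(\xi)|\le C_2e^{-\beta\xi^2}$$ for some $C_1,C_2,\alpha,\beta>0$. 1. If $\alpha\beta=\frac{\pi^2}{(a_1b_2-a_2b_1)^2}$, then there exists $A\in\mathbb{C}$ such that $$(\widehat{S^{(1)}}f)(x)=A\exp\left[-\left(\alpha+i\pi\,\frac{a_2d_1-b_2c_1}{a_1b_2-a_2b_1}\right)x^2\right].$$ 2. If $\alpha\beta>\frac{\pi^2}{(a_1b_2-a_2b_1)^2}$, then $f\equiv0$.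
   Context: $\operatorname{Sp}(2,\mathbb{R})$ is the group of real $2\times2$ matrices with determinant $1$. To each $S=\begin{pmatrix}a&b\\c&d\end{pmatrix}\in\operatorname{Sp}(2,\mathbb{R})$ correspond two unitary (metaplectic) operators $\pm\widehat S$ on $L^2(\mathbb{R})$ (they ''project onto $S$''). If $b\ne0$ ($S$ free), $$(\widehat Sf)(\xi)=\frac{\kappa}{\sqrt{|b|}}\int_{\mathbb{R}}f(x)\,e^{\frac{i\pi}{b}(d\xi^2+ax^2-2x\xi)}\,dx$$ with $\kappa$ a constant of modulus $1$ (fixed up to sign). Every $S\in\operatorname{Sp}(2,\mathbb{R})$ is a product $S=S_1S_2$ of two free matrices, and $\widehat S=\pm\widehat{S_1}\widehat{S_2}$. Pointwise statements about $L^2$ functions are understood almost everywhere. *)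

(* Defs.v *)
From HB Require Import structures.
From mathcomp Require Import all_boot all_order all_algebra.
From mathcomp Require Import all_classical all_reals all_analysis.
From mathcomp Require Import complex.

Set Implicit Arguments.
Unset Strict Implicit.
Unset Printing Implicit Defensive.

Import Order.TTheory GRing.Theory Num.Theory.
Import numFieldNormedType.Exports.

Local Open Scope classical_set_scope.
Local Open Scope ring_scope.
Local Open Scope complex_scope.

Definition cexp (R : realType) (z : R[i]) : R[i] :=
  (expR (complex.Re z))%:C * (cos (complex.Im z) +i* sin (complex.Im z)).

(* Complex-valued [L^p] on the real line: [p = 1] and [p = 2] are used below.
   Elements of [L^p] are represented by Borel functions, and are compared
   almost everywhere. *)
Definition cLfun (R : realType) (p : \bar R) (f : R -> R[i]) : Prop :=
  (fun x => complex.Re (f x)) \in Lfun (@lebesgue_measure R) p /\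
  (fun x => complex.Im (f x)) \in Lfun (@lebesgue_measure R) p.

(* Meaningful when the real and imaginary parts of [f] are integrable. *)
Definition cintegral (R : realType) (f : R -> R[i]) : R[i] :=
  (\int[@lebesgue_measure R]_x complex.Re (f x)) +i*
  (\int[@lebesgue_measure R]_x complex.Im (f x)).

Definition L2dot (R : realType) (f g : R -> R[i]) : R[i] :=
  cintegral (fun x => f x * (g x)^*).

(* An operator on [L^2] acts on representatives; compatibility with almost
   everywhere equality is a consequence of linearity and isometry. *)
Record unitaryL2 (R : realType) (T : (R -> R[i]) -> (R -> R[i])) : Prop := {
  unitaryL2_stable : forall f, cLfun 2%:E f -> cLfun 2%:E (T f);
  unitaryL2_linear : forall (k : R[i]) f g, cLfun 2%:E f -> cLfun 2%:E g ->
    {ae @lebesgue_measure R,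
      forall x, T (fun y => k * f y + g y) x = k * T f x + T g x};
  unitaryL2_dot : forall f g, cLfun 2%:E f -> cLfun 2%:E g ->
    L2dot (T f) (T g) = L2dot f g;
  unitaryL2_surj : forall g, cLfun 2%:E g ->
    exists2 f, cLfun 2%:E f & {ae @lebesgue_measure R, forall x, T f x = g x}
}.

Definition Sp2 (R : realType) (S : 'M[R]_2) : Prop := \det S = 1.

Definition free_Sp2 (R : realType) (S : 'M[R]_2) : Prop := S 0 1 != 0.

Definition metaplectic_kernel (R : realType) (S : 'M[R]_2) (xi x : R) : R[i] :=
  cexp (0 +i* (pi / S 0 1 *
    (S 1 1 * xi ^+ 2 + S 0 0 * x ^+ 2 - 2 * x * xi))).

(* The integral converges absolutely only for [f] in [L^1]; the formula on the
   dense subspace [L^1 \cap L^2] determines the unitary operator [T].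
   The unimodular constant is [kappa = +- exp (- i pi sgn(b) / 4)], i.e.
   [kappa ^ 2 = - i sgn(b)].  This is the only choice, up to sign, for which
   the product of operators over [S1], [S2] is an operator over [S1 *m S2]: the
   Fresnel integral in the composition of the kernels contributes
   [exp (i pi sgn(b b1 b2) / 4)]. *)
Definition free_metaplectic (R : realType) (S : 'M[R]_2)
    (T : (R -> R[i]) -> (R -> R[i])) : Prop :=
  [/\ Sp2 S, free_Sp2 S, unitaryL2 T &
   exists kappa : R[i], kappa ^+ 2 = 0 -i* Num.sg (S 0 1) /\
   forall f, cLfun 1%:E f -> cLfun 2%:E f ->
     {ae @lebesgue_measure R, forall xi, T f xi =
        kappa / (Num.sqrt `|S 0 1|)%:C *
        cintegral (fun x => f x * metaplectic_kernel S xi x)}].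

(* [T] is one of the two metaplectic operators projecting onto [S].  The second
   alternative covers the matrices that are not free, and is consistent with
   the first one for those that are. *)
Definition metaplectic (R : realType) (S : 'M[R]_2)
    (T : (R -> R[i]) -> (R -> R[i])) : Prop :=
  free_metaplectic S T \/
  unitaryL2 T /\
  exists (S1 S2 : 'M[R]_2) (T1 T2 : (R -> R[i]) -> (R -> R[i])) (s : bool),
    [/\ free_metaplectic S1 T1, free_metaplectic S2 T2, S = S1 *m S2 &
     forall f, cLfun 2%:E f ->
       {ae @lebesgue_measure R, forall x, T f x = (-1) ^+ s * T1 (T2 f) x}].

(* Main.v *)
Require Import Defs.
From HB Require Import structures.
From mathcomp Require Import all_boot all_order all_algebra.
From mathcomp Require Import all_classical all_reals all_analysis.
From mathcomp Require Import measurable_realfun lebesgue_integral_under.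
From mathcomp Require Import complex.
From mathcomp Require Import ring lra.

(** The operator [T2 T1^-1] lies over [S2 S1^-1], whose upper right entry is
    [b = a1 b2 - a2 b1] and whose upper left entry is [a = a2 d1 - b2 c1]. Up to
    chirps, [T2 f] is therefore the Fourier transform of [T1 f], rescaled by [b],
    and the statement is Hardy's uncertainty principle for
    [T1 f * exp (i pi a x^2 / b)].

    The composition [T2 T1^-1] is never computed as an integral operator.
    Instead, Gaussians are followed: a metaplectic operator over [S] maps the
    chirp [exp (i pi (p / q) x^2 + 2 i pi (r / q) x)], with [Im (p / q) > 0], to a
    constant multiple of the chirp of parameters [S (q, p)] and [r]
    ([metaplectic_chirp]); for free operators this is a Gaussian integral, and
    the rule is multiplicative. If [G] is such a chirp, unitarity gives
    [<T1 f, T1 G> = <f, G> = <T2 f, T2 G>], and comparing the norms of [T1 G] and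
    [T2 G] eliminates the constants ([chirp_transfer]). For a family of chirps
    indexed by the frequency [s], the left-hand side is the Fourier transform of
    [u = T1 f * exp (i pi a x^2 / b - pi x^2)] and the right-hand side is
    estimated by the decay of [T2 f] ([transfer_bound]). The extra factor
    [exp (- pi x^2)] replaces the rate [alpha] by [alpha + pi], and the rate of
    the transform changes accordingly: the excess over the critical rate keeps
    the sign of [alpha beta b^2 - pi^2].

    Hardy's theorem itself is proved for the transform
    [L w = \int u x * exp (w x) dx], entire since [u] has Gaussian decay. With
    [l = (4 (alpha + pi))^-1], the function [L w * exp (- l w^2)] is bounded by a
    multiple of [exp (l (Im w)^2)], and in the critical case it is bounded on the
    imaginary axis. A Phragmen-Lindelof argument in sectors
    ([phragmen_lindelof]) makes it bounded on the plane. Subtracting from [u] the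
    multiple of the Gaussian of rate [alpha + pi] that cancels [L 0], one gets
    [L = 0] by Liouville's theorem ([liouville]). Beyond the critical case the
    multiple has to be zero, for its transform decays too slowly. Both theorems
    are derived from an elementary maximum principle ([maximum_principle]): the
    squared modulus [N] of a holomorphic function satisfies
    [N (N_ss + N_tt) >= N_s^2 + N_t^2], so that [N e^-v] has no interior maximum
    when [v] is superharmonic. Only second derivatives along the two axes are
    involved, and they are obtained by differentiating under the integral.

    Finally a function whose transform vanishes on the imaginary axis is zero
    almost everywhere: a free metaplectic operator is a Fourier transform up to
    chirps, and its unitarity gives the injectivity ([fourier_injective]). *)

Import Order.TTheory GRing.Theory Num.Theory.
Import numFieldNormedType.Exports.
Import ComplexField.Normc.

Local Open Scope classical_set_scope.
Local Open Scope ring_scope.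
Local Open Scope complex_scope.

Set Implicit Arguments.
Unset Strict Implicit.
Unset Printing Implicit Defensive.

(** * The complex exponential and complex-valued curves *)

Section complex_basics.
Context {R : realType}.
Implicit Types z w : R[i].

Lemma complex_eqP z w : complex.Re z = complex.Re w ->
  complex.Im z = complex.Im w -> z = w.
Proof. by case: z => a b; case: w => c d /= -> ->. Qed.

Lemma ReD z w : complex.Re (z + w) = complex.Re z + complex.Re w.
Proof. by case: z => a b; case: w. Qed.

Lemma ImD z w : complex.Im (z + w) = complex.Im z + complex.Im w.
Proof. by case: z => a b; case: w. Qed.

Lemma ReN z : complex.Re (- z) = - complex.Re z.
Proof. by case: z. Qed.

Lemma ImN z : complex.Im (- z) = - complex.Im z.
Proof. by case: z. Qed.

Lemma ReM z w : complex.Re (z * w) =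
  complex.Re z * complex.Re w - complex.Im z * complex.Im w.
Proof. by case: z => a b; case: w. Qed.

Lemma ImM z w : complex.Im (z * w) =
  complex.Re z * complex.Im w + complex.Im z * complex.Re w.
Proof. by case: z => a b; case: w. Qed.

Lemma ReJ z : complex.Re z^* = complex.Re z. Proof. by case: z. Qed.

Lemma ImJ z : complex.Im z^* = - complex.Im z. Proof. by case: z. Qed.

Definition ReImE := (ReD, ImD, ReN, ImN, ReM, ImM, ReJ, ImJ).

Lemma Re_cexp z : complex.Re (cexp z) = expR (complex.Re z) * cos (complex.Im z).
Proof. by rewrite /cexp ReM /=; ring. Qed.

Lemma Im_cexp z : complex.Im (cexp z) = expR (complex.Re z) * sin (complex.Im z).
Proof. by rewrite /cexp ImM /=; ring. Qed.

Lemma cexp0 : cexp (0 : R[i]) = 1.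
Proof.
by apply: complex_eqP; rewrite ?Re_cexp ?Im_cexp /= expR0 ?cos0 ?sin0 mul1r.
Qed.

Lemma cexpD z w : cexp (z + w) = cexp z * cexp w.
Proof.
by apply: complex_eqP; rewrite !(ReImE, Re_cexp, Im_cexp) expRD ?cosD ?sinD;
  ring.
Qed.

Lemma cexpJ z : (cexp z)^* = cexp z^*.
Proof.
by apply: complex_eqP; rewrite !(ReImE, Re_cexp, Im_cexp) ?cosN ?sinN; ring.
Qed.

Lemma cexp_real (x : R) : cexp x%:C = (expR x)%:C.
Proof.
by apply: complex_eqP; rewrite ?(Re_cexp, Im_cexp) /= ?cos0 ?sin0 ?mulr1 ?mulr0.
Qed.

Lemma sqr_normcE z : normc z ^+ 2 = complex.Re z ^+ 2 + complex.Im z ^+ 2.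
Proof. by case: z => a b /=; rewrite sqr_sqrtr // addr_ge0 // sqr_ge0. Qed.

Lemma normc_ge0 z : 0 <= normc z.
Proof. by case: z => a b; exact: sqrtr_ge0. Qed.

Lemma normc_cexp z : normc (cexp z) = expR (complex.Re z).
Proof.
apply/eqP; rewrite -(@eqrXn2 _ 2) ?normc_ge0 ?expR_ge0 //.
by rewrite sqr_normcE Re_cexp Im_cexp !exprMn -mulrDr cos2Dsin2 mulr1.
Qed.

Lemma cexp_neq0 z : cexp z != 0.
Proof.
apply/eqP => z0; have := normc_cexp z; rewrite z0 normc0 => /eqP.
by rewrite eq_sym gt_eqF // expR_gt0.
Qed.

Lemma ler_Re_normc z : `|complex.Re z| <= normc z.
Proof.
rewrite -(@ler_pXn2r _ 2) ?nnegrE ?normc_ge0 //.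
by rewrite sqr_normcE -normrX ger0_norm ?sqr_ge0 // lerDl sqr_ge0.
Qed.

Lemma ler_Im_normc z : `|complex.Im z| <= normc z.
Proof.
rewrite -(@ler_pXn2r _ 2) ?nnegrE ?normc_ge0 //.
by rewrite sqr_normcE -normrX ger0_norm ?sqr_ge0 // lerDr sqr_ge0.
Qed.

Lemma ler_normc z : normc z <= `|complex.Re z| + `|complex.Im z|.
Proof.
rewrite -(@ler_pXn2r _ 2) ?nnegrE ?normc_ge0 ?addr_ge0 //.
rewrite sqr_normcE -(real_normK (num_real (complex.Re z))).
rewrite -(real_normK (num_real (complex.Im z))).
have := normr_ge0 (complex.Re z); have := normr_ge0 (complex.Im z); nra.
Qed.

Lemma normc_real (x : R) : normc x%:C = `|x|.
Proof. by rewrite /= expr0n /= addr0 sqrtr_sqr. Qed.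

Lemma normcJ z : normc z^* = normc z.
Proof. by case: z => a b /=; rewrite sqrrN. Qed.

Lemma normc_gt0 z : (0 < normc z) = (z != 0).
Proof.
rewrite lt_neqAle normc_ge0 andbT eq_sym; congr (~~ _).
by apply/eqP/eqP => [/eq0_normc|->]; last exact: normc0.
Qed.

Lemma normr_normc z : `|z| = (normc z)%:C.
Proof. by []. Qed.

Lemma ler_normc_real z (x : R) : (`|z| <= x%:C) = (normc z <= x).
Proof. by rewrite normr_normc lecR. Qed.

End complex_basics.

Section complex_derivative.
Context {R : realType}.

(** Stated on real and imaginary parts, so that the calculus and the integration
    theory of real-valued functions apply to each of them. *)
Definition is_cderive (f : R -> R[i]) (t : R) (d : R[i]) : Prop :=
  is_derive t 1 (fun x => complex.Re (f x)) (complex.Re d) /\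
  is_derive t 1 (fun x => complex.Im (f x)) (complex.Im d).

Implicit Types f g : R -> R[i].

Lemma is_cderive_eq f t d e : is_cderive f t d -> d = e -> is_cderive f t e.
Proof. by move=> ? <-. Qed.

Lemma is_cderive_cst c t : is_cderive (fun=> c) t 0.
Proof. by split; exact: is_derive_cst. Qed.

Lemma is_cderive_real t : is_cderive (fun x => x%:C) t 1.
Proof. by split => /=; [exact: is_derive_id | exact: is_derive_cst]. Qed.

Lemma is_cderiveD f g t d e : is_cderive f t d -> is_cderive g t e ->
  is_cderive (fun x => f x + g x) t (d + e).
Proof.
move=> [f1 f2] [g1 g2]; split.
  under eq_fun do rewrite ReD.
  by rewrite ReD; exact: is_deriveD.
under eq_fun do rewrite ImD.
by rewrite ImD; exact: is_deriveD.
Qed.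

Lemma is_cderiveM f g t d e : is_cderive f t d -> is_cderive g t e ->
  is_cderive (fun x => f x * g x) t (d * g t + f t * e).
Proof.
move=> [f1 f2] [g1 g2]; split.
  under eq_fun do rewrite ReM.
  apply: (is_derive_eq (is_deriveB (is_deriveM f1 g1) (is_deriveM f2 g2))).
  by rewrite !ReImE /GRing.scale /=; ring.
under eq_fun do rewrite ImM.
apply: (is_derive_eq (is_deriveD (is_deriveM f1 g2) (is_deriveM f2 g1))).
by rewrite !ReImE /GRing.scale /=; ring.
Qed.

Lemma is_cderive_cexp f t d : is_cderive f t d ->
  is_cderive (fun x => cexp (f x)) t (d * cexp (f t)).
Proof.
move=> [f1 f2].
have fe := is_derive1_comp (is_derive_expR (complex.Re (f t))) f1.
have fc := is_derive1_comp (is_derive_cos (complex.Im (f t))) f2.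
have fs := is_derive1_comp (is_derive_sin (complex.Im (f t))) f2.
split.
  under eq_fun do rewrite Re_cexp.
  apply: (is_derive_eq (is_deriveM fe fc)).
  by rewrite !(ReImE, Re_cexp, Im_cexp) /GRing.scale /=; ring.
under eq_fun do rewrite Im_cexp.
apply: (is_derive_eq (is_deriveM fe fs)).
by rewrite !(ReImE, Re_cexp, Im_cexp) /GRing.scale /=; ring.
Qed.

Lemma is_cderive0_cst f x y : (forall t, is_cderive f t 0) -> f x = f y.
Proof.
move=> f0; apply: complex_eqP.
  by apply: (is_derive_0_is_cst (f := fun x => complex.Re (f x))) => t;
     have [] := f0 t.
by apply: (is_derive_0_is_cst (f := fun x => complex.Im (f x))) => t;
   have [] := f0 t.
Qed.

End complex_derivative.

(** * Integration of complex-valued functions *)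

Section complex_integral.
Context {R : realType}.
Notation mu := (@lebesgue_measure R).
Implicit Types (u v : R -> R[i]) (g h : R -> R).

Lemma ae_imp (P Q : R -> Prop) : (forall x, P x -> Q x) ->
  {ae mu, forall x, P x} -> {ae mu, forall x, Q x}.
Proof. by move=> PQ; apply: (@filterS _ _ (ae_filter_ringOfSetsType mu)). Qed.

Lemma ae_imp2 (P P' Q : R -> Prop) : (forall x, P x -> P' x -> Q x) ->
  {ae mu, forall x, P x} -> {ae mu, forall x, P' x} -> {ae mu, forall x, Q x}.
Proof. by move=> PQ; apply: (@filterS2 _ _ (ae_filter_ringOfSetsType mu)). Qed.

Definition cmeasurable u : Prop :=
  measurable_fun setT (fun x => complex.Re (u x)) /\
  measurable_fun setT (fun x => complex.Im (u x)).

Definition cintegrable u : Prop :=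
  mu.-integrable setT (EFin \o (fun x => complex.Re (u x))) /\
  mu.-integrable setT (EFin \o (fun x => complex.Im (u x))).

Lemma cmeasurableM u v : cmeasurable u -> cmeasurable v ->
  cmeasurable (fun x => u x * v x).
Proof.
move=> [u1 u2] [v1 v2]; split.
  under eq_fun do rewrite ReM.
  by apply: measurable_funB; apply: measurable_funM.
under eq_fun do rewrite ImM.
by apply: measurable_funD; apply: measurable_funM.
Qed.

Lemma cmeasurableD u v : cmeasurable u -> cmeasurable v ->
  cmeasurable (fun x => u x + v x).
Proof.
move=> [u1 u2] [v1 v2]; split.
  by under eq_fun do rewrite ReD; exact: measurable_funD.
by under eq_fun do rewrite ImD; exact: measurable_funD.
Qed.

Lemma cmeasurable_cst c : cmeasurable (fun=> c).
Proof. by split; exact: measurable_cst. Qed.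

Lemma cmeasurable_real g : measurable_fun setT g ->
  cmeasurable (fun x => (g x)%:C).
Proof. by move=> mg; split => //=; exact: measurable_cst. Qed.

Lemma cmeasurable_id : cmeasurable (fun x => x%:C).
Proof. by apply: cmeasurable_real; exact: measurable_id. Qed.

Lemma cmeasurableJ u : cmeasurable u -> cmeasurable (fun x => (u x)^*).
Proof.
move=> [u1 u2]; split.
  by under eq_fun do rewrite ReJ.
by under eq_fun do rewrite ImJ; exact: measurableT_comp.
Qed.

Lemma cmeasurable_cexp u : cmeasurable u -> cmeasurable (fun x => cexp (u x)).
Proof.
move=> [u1 u2].
have e : measurable_fun setT (fun x => expR (complex.Re (u x))).
  exact: measurableT_comp.
split.
  under eq_fun do rewrite Re_cexp; apply: measurable_funM => //.
  apply: (measurableT_comp (f := @cos R)) => //.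
  by apply: continuous_measurable_fun; exact: continuous_cos.
under eq_fun do rewrite Im_cexp; apply: measurable_funM => //.
apply: (measurableT_comp (f := @sin R)) => //.
by apply: continuous_measurable_fun; exact: continuous_sin.
Qed.

Lemma le_integrableR g h : measurable_fun setT g ->
  (forall x, `|g x| <= h x) -> mu.-integrable setT (EFin \o h) ->
  mu.-integrable setT (EFin \o g).
Proof.
move=> mg gh; apply: le_integrable => //; first exact/measurable_EFinP.
by move=> x _; rewrite /= lee_fin (le_trans (gh x)) ?ler_norm.
Qed.

Lemma cintegrable_le u g : cmeasurable u -> (forall x, normc (u x) <= g x) ->
  mu.-integrable setT (EFin \o g) -> cintegrable u.
Proof.
move=> [u1 u2] ug ig; split; apply: le_integrableR ig => // x.
  exact: le_trans (ler_Re_normc _) (ug x).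
exact: le_trans (ler_Im_normc _) (ug x).
Qed.

Lemma eq_cintegral u v : (forall x, u x = v x) -> cintegral u = cintegral v.
Proof. by move=> uv; congr cintegral; apply/funext. Qed.

Lemma cintegralD u v : cintegrable u -> cintegrable v ->
  cintegral (fun x => u x + v x) = cintegral u + cintegral v.
Proof.
move=> [u1 u2] [v1 v2]; apply: complex_eqP; rewrite ?ReD ?ImD /=.
  by rewrite -RintegralD //; apply: eq_Rintegral => x _; rewrite ReD.
by rewrite -RintegralD //; apply: eq_Rintegral => x _; rewrite ImD.
Qed.

Lemma integrableRZ g (k : R) : mu.-integrable setT (EFin \o g) ->
  mu.-integrable setT (EFin \o (fun x => k * g x)).
Proof.
move=> ig; rewrite (_ : _ \o _ = (fun x => k%:E * (EFin \o g) x)%E) //.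
exact: integrableZl.
Qed.

Lemma cintegrableZ c u : cintegrable u -> cintegrable (fun x => c * u x).
Proof.
move=> [u1 u2]; split.
  rewrite (_ : _ \o _ = ((EFin \o (fun x => (complex.Re c * complex.Re (u x))%R)) \-
    (EFin \o (fun x => (complex.Im c * complex.Im (u x))%R)))%E).
    by apply: integrableB => //; exact: integrableRZ.
  by apply/funext => x; rewrite /= ReM.
rewrite (_ : _ \o _ = ((EFin \o (fun x => (complex.Re c * complex.Im (u x))%R)) \+
  (EFin \o (fun x => (complex.Im c * complex.Re (u x))%R)))%E).
  by apply: integrableD => //; exact: integrableRZ.
by apply/funext => x; rewrite /= ImM.
Qed.

Lemma cintegralZ c u : cintegrable u ->
  cintegral (fun x => c * u x) = c * cintegral u.
Proof.
move=> [u1 u2]; apply: complex_eqP; rewrite ?ReM ?ImM /=.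
  rewrite -!RintegralZl // -RintegralB //; try exact: integrableRZ.
  by apply: eq_Rintegral => x _; rewrite ReM.
rewrite -!RintegralZl // -RintegralD //; try exact: integrableRZ.
by apply: eq_Rintegral => x _; rewrite ImM.
Qed.

(** The factor [2] is the price of bounding the real and imaginary parts
    separately; it disappears in the unspecified constants of Hardy's theorem. *)
Lemma normc_cintegral_le u g : cmeasurable u ->
  (forall x, normc (u x) <= g x) -> mu.-integrable setT (EFin \o g) ->
  normc (cintegral u) <= 2 * \int[mu]_x g x.
Proof.
move=> mu_ ug ig; have [u1 u2] := cintegrable_le mu_ ug ig.
apply: (le_trans (ler_normc _)); rewrite mulr_natl mulr2n /=.
apply: lerD; apply: (le_trans (le_normr_Rintegral _ _)) => //.
  apply: le_Rintegral => //; last first.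
    by move=> x _; exact: le_trans (ler_Re_normc _) (ug x).
  exact: (integrable_norm u1).
apply: le_Rintegral => //; last first.
  by move=> x _; exact: le_trans (ler_Im_normc _) (ug x).
exact: (integrable_norm u2).
Qed.

Lemma cintegral_ae u v : cmeasurable u -> cmeasurable v ->
  {ae mu, forall x, u x = v x} -> cintegral u = cintegral v.
Proof.
move=> [u1 u2] [v1 v2] uv; apply: complex_eqP => /=; congr fine.
  apply: ae_eq_integral => //; try exact/measurable_EFinP.
  by apply: ae_imp uv => x /= -> _.
apply: ae_eq_integral => //; try exact/measurable_EFinP.
by apply: ae_imp uv => x /= -> _.
Qed.

(** The neighbourhood has radius one because every domination used below is
    locally uniform in the parameter. *)
Lemma is_derive_Rintegral (f df : R -> R -> R) (g : R -> R) (a : R) :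
  (forall t, mu.-integrable setT (EFin \o f t)) ->
  (forall t x : R, is_derive t (1 : R) (f ^~ x) (df t x)) ->
  (forall t x, `|t - a| < 1 -> `|df t x| <= g x) ->
  mu.-integrable setT (EFin \o g) ->
  is_derive a (1 : R) (fun t : R => \int[mu]_x f t x) (\int[mu]_x df a x).
Proof.
move=> intf derf dfg ig.
have dE t x : partial1of2 f t x = df t x.
  by rewrite partial1of2E; have [_ ->] := derf t x.
have aI : `]a - 1, a + 1[%classic a by rewrite /= in_itv /=; lra.
have tI t : `]a - 1, a + 1[%classic t -> `|t - a| < 1.
  by rewrite /= in_itv /= ltr_norml => /andP[? ?]; lra.
have g0 x : 0 <= g x.
  by apply: le_trans (dfg a x _) => //; rewrite subrr normr0.
have h1 : forall x, `]a - 1, a + 1[%classic x -> mu.-integrable setT (EFin \o f x).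
  by move=> x _; exact: intf.
have h2 : forall x y, `]a - 1, a + 1[%classic x -> [set: R] y ->
    derivable (f ^~ y) x 1.
  by move=> x y _ _; have [] := derf x y.
have h3 : forall x y, `]a - 1, a + 1[%classic x -> [set: R] y ->
    `|partial1of2 f x y| <= g y.
  by move=> x y xI _; rewrite dE; exact/dfg/tI.
apply: DeriveDef.
  exact: (@derivable_under_integral R _ _ mu f setT measurableT a (a-1) (a+1)
    aI h1 h2 g g0 ig h3).
rewrite -derive1E.
rewrite (@differentiation_under_integral R _ _ mu f setT measurableT a (a-1)
  (a+1) aI h1 h2 g g0 ig h3).
by apply: eq_Rintegral => x _; rewrite dE.
Qed.

Lemma is_cderive_cintegral (f df : R -> R -> R[i]) (g : R -> R) (a : R) :
  (forall t, cintegrable (f t)) ->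
  (forall t x : R, is_cderive (f ^~ x) t (df t x)) ->
  (forall t x, `|t - a| < 1 -> normc (df t x) <= g x) ->
  mu.-integrable setT (EFin \o g) ->
  is_cderive (fun t => cintegral (f t)) a (cintegral (df a)).
Proof.
move=> intf derf dfg ig; split => /=.
  apply: (@is_derive_Rintegral (fun t x => complex.Re (f t x))
    (fun t x => complex.Re (df t x)) g) => //.
  - by move=> t; have [] := intf t.
  - by move=> t x; have [] := derf t x.
  - by move=> t x ta; exact: le_trans (ler_Re_normc _) (dfg t x ta).
apply: (@is_derive_Rintegral (fun t x => complex.Im (f t x))
  (fun t x => complex.Im (df t x)) g) => //.
- by move=> t; have [] := intf t.
- by move=> t x; have [] := derf t x.
- by move=> t x ta; exact: le_trans (ler_Im_normc _) (dfg t x ta).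
Qed.

End complex_integral.

(** * Real Gaussians *)

Section real_gaussians.
Context {R : realType}.
Notation mu := (@lebesgue_measure R).
Implicit Types a m : R.

Definition gauss a m (x : R) : R := expR (- a * (x - m) ^+ 2).

Definition gint a : R := \int[mu]_x gauss a 0 x.

(** Integrability of Gaussians, and the independence of their mass from the
    centre, are inherited from the normal densities of variance [(2 a)^-1]. *)
Lemma gauss_normal a m : 0 < a ->
  let s := Num.sqrt (2 * a)^-1 in
  normal_pdf m s = fun x => normal_peak s * gauss a m x.
Proof.
move=> a0 s; have s0 : s != 0.
  by rewrite gt_eqF // sqrtr_gt0 invr_gt0 mulr_gt0.
apply/funext => x; rewrite normal_pdfE // /normal_fun /gauss.
congr (_ * expR _); rewrite sqr_sqrtr ?invr_ge0 ?mulr_ge0 ?(ltW a0) //.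
by rewrite -mulr_natr; field; rewrite gt_eqF.
Qed.

Lemma normal_peak_rate_gt0 a : 0 < a ->
  0 < normal_peak (Num.sqrt (2 * a)^-1 : R).
Proof.
by move=> a0; rewrite normal_peak_gt0 // gt_eqF // sqrtr_gt0 invr_gt0 mulr_gt0.
Qed.

Lemma integrable_gauss a m : 0 < a ->
  mu.-integrable setT (EFin \o gauss a m).
Proof.
move=> a0; have p0 := normal_peak_rate_gt0 a0.
have := integrable_normal_pdf m (Num.sqrt (2 * a)^-1).
rewrite gauss_normal // => /(integrableRZ (normal_peak (Num.sqrt (2 * a)^-1))^-1).
by congr (_.-integrable _ _); apply/funext => x /=; rewrite mulKf // gt_eqF.
Qed.

Lemma Rintegral_gauss_peak a m : 0 < a ->
  normal_peak (Num.sqrt (2 * a)^-1) * \int[mu]_x gauss a m x = 1.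
Proof.
move=> a0; rewrite -RintegralZl ?integrable_gauss //.
have := integral_normal_pdf m (Num.sqrt (2 * a)^-1).
by rewrite gauss_normal // /Rintegral => ->.
Qed.

Lemma gint_gt0 a : 0 < a -> 0 < gint a.
Proof.
move=> a0; have p0 := normal_peak_rate_gt0 a0.
by rewrite -(pmulr_rgt0 _ p0) Rintegral_gauss_peak.
Qed.

Lemma Rintegral_gauss a m : 0 < a -> \int[mu]_x gauss a m x = gint a.
Proof.
move=> a0; apply: (mulfI (lt0r_neq0 (normal_peak_rate_gt0 a0))).
by rewrite !Rintegral_gauss_peak.
Qed.

Lemma gauss_complete_square a (s x : R) : 0 < a ->
  expR (- a * x ^+ 2 + s * x) =
  expR (s ^+ 2 / (4 * a)) * gauss a (s / (2 * a)) x.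
Proof.
move=> a0; rewrite /gauss -expRD; congr expR.
by field; rewrite gt_eqF.
Qed.

Lemma integrable_gauss_exp a (s : R) : 0 < a ->
  mu.-integrable setT (EFin \o (fun x => expR (- a * x ^+ 2 + s * x))).
Proof.
move=> a0; under eq_fun do rewrite gauss_complete_square //.
exact/integrableRZ/integrable_gauss.
Qed.

Lemma Rintegral_gauss_exp a (s : R) : 0 < a ->
  \int[mu]_x expR (- a * x ^+ 2 + s * x) = expR (s ^+ 2 / (4 * a)) * gint a.
Proof.
move=> a0; under eq_Rintegral do rewrite gauss_complete_square //.
by rewrite RintegralZl ?integrable_gauss // Rintegral_gauss.
Qed.

End real_gaussians.

(** * Laplace transforms of functions with Gaussian decay *)

Section translation.
Context {R : realType}.
Notation mu := (@lebesgue_measure R).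

Lemma ge0_integral_translation (G : R -> R) (y : R) :
  continuous G -> (forall x, 0 <= G x) ->
  (\int[mu]_x (G (x + y))%:E = \int[mu]_x (G x)%:E)%E.
Proof.
move=> cG G0; pose F (x : R^o) : R^o := x + y.
have F'E : F^`()%classic = cst 1.
  by apply/funext => x; rewrite /F derive1E deriveD // derive_id derive_cst addr0.
rewrite (@increasing_ge0_integration_by_substitutionT R F G) //.
- by rewrite F'E; apply: eq_integral => x _; rewrite /= fctE mulr1.
- by move=> a b ab; rewrite /F ltrD2r.
- by rewrite F'E => ?; exact: cvg_cst.
- by rewrite F'E; exact: is_cvg_cst.
- by rewrite F'E; exact: is_cvg_cst.
- exact: cvg_addrr_Ny.
- exact: cvg_addrr.
Qed.

Lemma Rintegral_translation (G : R -> R) (y : R) : continuous G ->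
  \int[mu]_x G (x + y) = \int[mu]_x G x.
Proof.
move=> cG; congr fine; rewrite integralE [RHS]integralE.
have cp : continuous (fun x => Num.max (G x) 0).
  by move=> x; apply: (@continuous_max _ _ G (fun=> 0) x); [exact: cG|exact: cvg_cst].
have cn : continuous (fun x => Num.max (- G x) 0).
  move=> x; apply: (@continuous_max _ _ (fun x => - G x) (fun=> 0) x).
    by apply: (@cvgN _ R^o); exact: cG.
  exact: cvg_cst.
have pE (H : R -> R) : ((fun x => (H x)%:E)^\+ = fun x => (Num.max (H x) 0)%:E)%E.
  by apply/funext => x; rewrite funeposE EFin_max.
have nE (H : R -> R) : ((fun x => (H x)%:E)^\- = fun x => (Num.max (- H x) 0)%:E)%E.
  by apply/funext => x; rewrite funenegE EFin_max EFinN.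
rewrite !pE !nE; congr (_ - _)%E.
  apply: (@ge0_integral_translation (fun x => Num.max (G x) 0)) => // x.
  by rewrite le_max lexx orbT.
apply: (@ge0_integral_translation (fun x => Num.max (- G x) 0)) => // x.
by rewrite le_max lexx orbT.
Qed.

Lemma cintegral_translation (u : R -> R[i]) (y : R) :
  (forall x, exists d, is_cderive u x d) ->
  cintegral (fun x => u (x + y)) = cintegral u.
Proof.
move=> du; congr Complex.
  apply: (@Rintegral_translation (fun x => complex.Re (u x))) => x.
  have [d [[dd _] _]] := du x.
  exact/differentiable_continuous/derivable1_diffP.
apply: (@Rintegral_translation (fun x => complex.Im (u x))) => x.
have [d [_ [dd _]]] := du x.
exact/differentiable_continuous/derivable1_diffP.
Qed.

End translation.

Section laplace.
Context {R : realType}.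
Notation mu := (@lebesgue_measure R).
Implicit Types (u v : R -> R[i]) (w z : R[i]) (C a : R).

Definition gdominated C a u : Prop :=
  cmeasurable u /\ forall x, normc (u x) <= C * expR (- a * x ^+ 2).

Definition laplace u w : R[i] := cintegral (fun x => u x * cexp (w * x%:C)).

Lemma Re_mulr_real w (x : R) : complex.Re (w * x%:C) = complex.Re w * x.
Proof. by rewrite ReM /= mulr0 subr0. Qed.

Lemma cmeasurable_laplace u w : cmeasurable u ->
  cmeasurable (fun x => u x * cexp (w * x%:C)).
Proof.
move=> mu_; apply/(cmeasurableM mu_)/cmeasurable_cexp/cmeasurableM.
  exact: cmeasurable_cst.
exact: cmeasurable_id.
Qed.

Lemma gdominated_laplace_le C a u w x : gdominated C a u ->
  normc (u x * cexp (w * x%:C)) <=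
  C * expR (- a * x ^+ 2 + complex.Re w * x).
Proof.
move=> [_ ub]; rewrite normcM normc_cexp Re_mulr_real expRD mulrA.
by rewrite ler_wpM2r ?expR_ge0.
Qed.

Lemma cintegrable_laplace C a u w : 0 < a -> gdominated C a u ->
  cintegrable (fun x => u x * cexp (w * x%:C)).
Proof.
move=> a0 ub; apply: cintegrable_le (fun x => gdominated_laplace_le w x ub) _.
  by case: ub => ? _; exact: cmeasurable_laplace.
exact/integrableRZ/integrable_gauss_exp.
Qed.

Lemma normc_laplace_le C a u w : 0 < a -> gdominated C a u ->
  normc (laplace u w) <=
  2 * C * gint a * expR (complex.Re w ^+ 2 / (4 * a)).
Proof.
move=> a0 ub; apply: le_trans (normc_cintegral_le _
  (fun x => gdominated_laplace_le w x ub) _) _.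
- by case: ub => ? _; exact: cmeasurable_laplace.
- exact/integrableRZ/integrable_gauss_exp.
rewrite RintegralZl ?integrable_gauss_exp // Rintegral_gauss_exp //.
by rewrite le_eqVlt; apply/orP; left; apply/eqP; ring.
Qed.

Lemma gdominated_ge0 C a u : gdominated C a u -> 0 <= C.
Proof.
move=> [_ /(_ 0)]; rewrite expr0n mulr0 expR0 mulr1.
exact/le_trans/normc_ge0.
Qed.

(** By [1 + y <= expR y], half of the rate absorbs the factor [x]. *)
Lemma gdominated_mulx C a u : 0 < a -> gdominated C a u ->
  gdominated (C * (1 + 2 / a)) (a / 2) (fun x => x%:C * u x).
Proof.
move=> a0 ub; have C0 := gdominated_ge0 ub; case: ub => mu_ ub; split.
  by apply: cmeasurableM => //; exact: cmeasurable_id.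
move=> x; rewrite normcM normc_real.
have ai : 0 < a^-1 by rewrite invr_gt0.
have x1 : `|x| <= (1 + 2 / a) * expR (a / 2 * x ^+ 2).
  have := expR_ge1Dx (a / 2 * x ^+ 2).
  have aa : a * a^-1 = 1 by rewrite divff // gt_eqF.
  rewrite -(ler_pM2l (_ : 0 < 1 + 2 / a)); last by lra.
  move/(le_trans _); apply; rewrite -(real_normK (num_real x)).
  have := normr_ge0 x; move: (`|x|) => y y0.
  have -> : (1 + 2 / a) * (1 + a / 2 * y ^+ 2) =
    1 + 2 / a + a / 2 * y ^+ 2 + (a * a^-1) * y ^+ 2 by field; rewrite gt_eqF.
  rewrite aa; have : 0 <= a / 2 * y ^+ 2 by rewrite mulr_ge0 ?sqr_ge0 //; lra.
  nra.
apply: le_trans (ler_pM (normr_ge0 _) (normc_ge0 _) x1 (ub x)) _.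
rewrite mulrACA -expRD [_ * C]mulrC ler_wpM2l //; first by rewrite mulr_ge0 //; lra.
by rewrite ler_expR; lra.
Qed.

(** The complex derivative of the Laplace transform of [u] is that of [x u].
    Lines of every direction [c] are allowed: the horizontal and vertical ones
    give the Cauchy-Riemann equations, and [laplace_cgauss] follows the
    direction [2 z] as well as rays. *)
Lemma is_cderive_laplace C a u w c (t0 : R) : 0 < a -> gdominated C a u ->
  is_cderive (fun t => laplace u (w + c * t%:C)) t0
    (c * laplace (fun x => x%:C * u x) (w + c * t0%:C)).
Proof.
move=> a0 ub; have ub1 := gdominated_mulx a0 ub.
have C1 := gdominated_ge0 ub1.
have a2 : 0 < a / 2 by lra.
have a4 : 0 < a / 4 by lra.
rewrite -cintegralZ; last exact: cintegrable_laplace ub1.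
pose M := `|complex.Re w| + `|complex.Re c| * (`|t0| + 1).
apply: (@is_cderive_cintegral _
  (fun t x => u x * cexp ((w + c * t%:C) * x%:C))
  (fun t x => c * (x%:C * u x * cexp ((w + c * t%:C) * x%:C)))
  (fun x => normc c * (C * (1 + 2 / a)) * expR (M ^+ 2 / a)
            * expR (- (a / 4) * x ^+ 2))).
- by move=> t; exact: cintegrable_laplace ub.
- move=> t x; apply: is_cderive_eq.
    apply: is_cderiveM; first exact: is_cderive_cst.
    apply/is_cderive_cexp/is_cderiveM; last exact: is_cderive_cst.
    apply: is_cderiveD; first exact: is_cderive_cst.
    apply: is_cderiveM; first exact: is_cderive_cst.
    exact: is_cderive_real.
  by cbv beta; ring.
- move=> t x tt0; rewrite normcM.
  apply: (@le_trans _ _ (normc c * (C * (1 + 2 / a) *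
     expR (- (a / 2) * x ^+ 2 + complex.Re (w + c * t%:C) * x)))).
    by rewrite ler_wpM2l ?normc_ge0 //; exact: (gdominated_laplace_le _ _ ub1).
  have -> : normc c * (C * (1 + 2 / a)) * expR (M ^+ 2 / a) *
      expR (- (a / 4) * x ^+ 2) = normc c * (C * (1 + 2 / a) *
        (expR (M ^+ 2 / a) * expR (- (a / 4) * x ^+ 2))) by rewrite !mulrA.
  rewrite ler_wpM2l ?normc_ge0 // ler_wpM2l // -expRD.
  rewrite ler_expR.
  have h : complex.Re (w + c * t%:C) * x <= M * `|x|.
    rewrite (le_trans (ler_norm _)) // normrM ler_wpM2r //.
    rewrite ReD Re_mulr_real (le_trans (ler_normD _ _)) // lerD2l normrM.
    rewrite ler_wpM2l // -(subrK t0 t) (le_trans (ler_normD _ _)) //.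
    by rewrite addrC lerD2l ltW.
  have -> : x ^+ 2 = `|x| ^+ 2 by rewrite real_normK ?num_real.
  apply: le_trans (lerD (lexx _) h) _; rewrite -subr_ge0.
  have -> : M ^+ 2 / a + - (a / 4) * `|x| ^+ 2 -
     (- (a / 2) * `|x| ^+ 2 + M * `|x|) = (M - a / 2 * `|x|) ^+ 2 / a.
    by field; rewrite gt_eqF.
  by rewrite divr_ge0 ?sqr_ge0 // ltW.
- apply: integrableRZ; have := integrable_gauss 0 a4.
  by congr (_.-integrable _ _); apply/funext => x; rewrite /= /gauss subr0.
Qed.

Lemma laplaceB C a u C' a' v k w : 0 < a -> gdominated C a u -> 0 < a' ->
  gdominated C' a' v ->
  laplace (fun x => u x - k * v x) w = laplace u w - k * laplace v w.
Proof.
move=> a0 ub a0' vb; have iu := cintegrable_laplace w a0 ub.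
have iv := cintegrable_laplace w a0' vb.
rewrite -mulNr -cintegralZ // /laplace -cintegralD //.
  by apply: eq_cintegral => x; ring.
exact: cintegrableZ.
Qed.

End laplace.

Section complex_gaussian.
Context {R : realType}.
Variable z : R[i].
Hypothesis z0 : 0 < complex.Re z.

Definition cgauss (x : R) : R[i] := cexp (- z * (x ^+ 2)%:C).

Lemma cmeasurable_cgauss : cmeasurable cgauss.
Proof.
apply/cmeasurable_cexp/cmeasurableM; first exact: cmeasurable_cst.
by apply: cmeasurable_real; exact: measurable_funX.
Qed.

Lemma gdominated_cgauss : gdominated 1 (complex.Re z) cgauss.
Proof.
split; first exact: cmeasurable_cgauss.
by move=> x; rewrite normc_cexp mul1r ReM ReN /= mulr0 subr0.
Qed.

Let translate (w : R[i]) (t : R) :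
  laplace cgauss (w + 2 * z * t%:C) =
  cexp (z * (t ^+ 2)%:C + w * t%:C) * laplace cgauss w.
Proof.
have iw := cintegrable_laplace w z0 gdominated_cgauss.
rewrite -cintegralZ //.
rewrite -(@cintegral_translation R (fun x : R =>
  cexp (z * (t ^+ 2)%:C + w * t%:C) * (cgauss x * cexp (w * x%:C))) (- t)).
  apply: eq_cintegral => x; rewrite /cgauss -!cexpD; congr cexp.
  rewrite !rmorphXn /= !rmorphD /= !rmorphN /=; ring.
move=> x; exists (cexp (z * (t ^+ 2)%:C + w * t%:C) *
  ((- z * (2 * x%:C) + w) * (cgauss x * cexp (w * x%:C)))).
apply: is_cderive_eq.
  apply: is_cderiveM; first exact: is_cderive_cst.
  apply: is_cderiveM.
    apply/is_cderive_cexp/is_cderiveM; first exact: is_cderive_cst.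
    have -> : (fun x : R => (x ^+ 2)%:C) = (fun x => x%:C * x%:C).
      by apply/funext => y; rewrite expr2 rmorphM.
    by apply: is_cderiveM; exact: is_cderive_real.
  apply/is_cderive_cexp/is_cderiveM; first exact: is_cderive_cst.
  exact: is_cderive_real.
by rewrite /cgauss; ring.
Qed.

Lemma is_cderive_unique (f : R -> R[i]) t d e :
  is_cderive f t d -> is_cderive f t e -> d = e.
Proof.
by move=> [[_ d1] [_ d2]] [[_ e1] [_ e2]]; apply: complex_eqP;
  [rewrite -d1 -e1|rewrite -d2 -e2].
Qed.

Let laplace_ode (w : R[i]) :
  2 * z * laplace (fun x => x%:C * cgauss x) w = w * laplace cgauss w.
Proof.
have d1 := is_cderive_laplace w (2 * z) 0 z0 gdominated_cgauss.
rewrite mulr0 addr0 in d1.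
have d2 : is_cderive (fun t => laplace cgauss (w + 2 * z * t%:C)) 0
   (w * laplace cgauss w).
  rewrite (funext (translate w)); apply: is_cderive_eq.
    apply: is_cderiveM; last exact: is_cderive_cst.
    apply/is_cderive_cexp/is_cderiveD.
      apply: is_cderiveM; first exact: is_cderive_cst.
      have -> : (fun x : R => (x ^+ 2)%:C) = (fun x => x%:C * x%:C).
        by apply/funext => y; rewrite expr2 rmorphM.
      by apply: is_cderiveM; exact: is_cderive_real.
    apply: is_cderiveM; first exact: is_cderive_cst.
    exact: is_cderive_real.
  cbv beta; have -> : z * (0 ^+ 2)%:C + w * 0%:C = 0 :> R[i].
    by rewrite expr0n /= !mulr0 addr0.
  by rewrite cexp0; ring.
exact: is_cderive_unique d1 d2.
Qed.

(** Translating the variable of integration by [t] relates the values of the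
    transform [L] at [w + 2 z t] and at [w]; differentiating this relation at
    [t = 0] gives [2 z L' = w L], which is then integrated along the ray from [0]
    to [w]. No contour of integration has to be moved. *)
Lemma laplace_cgauss (w : R[i]) :
  laplace cgauss w = laplace cgauss 0 * cexp (w ^+ 2 / (4 * z)).
Proof.
have zn0 : z != 0 by apply/eqP => zE; move: z0; rewrite zE ltxx.
pose E (t : R) := laplace cgauss (0 + w * t%:C) *
  cexp (- (w ^+ 2 / (4 * z)) * (t%:C * t%:C)).
have E10 : E 1 = E 0.
  apply: is_cderive0_cst => t; apply: is_cderive_eq.
    apply: is_cderiveM; first exact: is_cderive_laplace gdominated_cgauss.
    apply/is_cderive_cexp/is_cderiveM; first exact: is_cderive_cst.
    by apply: is_cderiveM; exact: is_cderive_real.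
  rewrite !add0r; have := laplace_ode (w * t%:C).
  set L1 := laplace (fun x => _) _; set L0 := laplace _ _ => ode.
  have -> : L1 = w * t%:C * L0 / (2 * z) by rewrite -ode; field.
  by field.
move: E10; rewrite /E !add0r !mulr0 mulr1 cexp0 !mulr1 => <-.
by rewrite -mulrA -cexpD addNr cexp0 mulr1.
Qed.

End complex_gaussian.

(** * The maximum principle for log-subharmonic functions *)

Section calculus.
Context {R : realType}.
Implicit Types (f g : R -> R) (x d : R).

(** The form in which auxiliary small exponents are removed from an estimate. *)
Lemma ler_expR_eps (x y c : R) : 0 <= y ->
  (forall e, 0 < e -> x <= y * expR (e * c)) -> x <= y.
Proof.
move=> y0 h; rewrite leNgt; apply/negP => yx.
have x0 : 0 < x by exact: le_lt_trans yx.
have yp : 0 < y.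
  by rewrite lt_neqAle y0 andbT; apply/eqP => yE; have := h 1 ltr01;
     rewrite -yE mul0r leNgt x0.
have [c0|c0] := leP c 0.
  have := h 1 ltr01; rewrite leNgt (le_lt_trans _ yx) //.
  by rewrite -[leRHS]mulr1 ler_wpM2l // mul1r -expR0 ler_expR.
have L0 : 0 < ln (x / y) by rewrite ln_gt0 // ltr_pdivlMr // mul1r.
have e0 : 0 < ln (x / y) / (2 * c) by rewrite divr_gt0 // mulr_gt0.
have := h _ e0; rewrite leNgt => /negP; apply.
have -> : ln (x / y) / (2 * c) * c = ln (x / y) / 2 by field; rewrite gt_eqF.
apply: (@lt_le_trans _ _ (y * expR (ln (x / y)))).
  by rewrite ltr_pM2l // ltr_expR; lra.
by rewrite lnK ?posrE ?divr_gt0 // mulrC divfK // gt_eqF.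
Qed.

Lemma is_derive_continuous f x (d : R) : is_derive x 1 f d ->
  {for x, continuous f}.
Proof. by move=> [dd _]; exact/differentiable_continuous/derivable1_diffP. Qed.

Lemma second_derive_max f f1 x (f2 d : R) : 0 < d ->
  (forall y, `|y - x| < d -> is_derive y 1 f (f1 y)) ->
  is_derive x 1 f1 f2 ->
  (forall y, `|y - x| < d -> f y <= f x) -> f1 x = 0 /\ f2 <= 0.
Proof.
move=> d0 df df1 fmax.
have inI y : y \in `]x - d, x + d[ -> `|y - x| < d.
  by rewrite in_itv /= ltr_norml => /andP[? ?]; lra.
have f1x0 : f1 x = 0.
  have xx : `|x - x| < d by rewrite subrr normr0.
  have := @derive1_at_max R f (x - d) (x + d) x.
  case; first by lra.
  - by move=> t /inI /df [].
  - by rewrite in_itv /=; lra.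
  - by move=> t /inI; exact: fmax.
  by have [_ ->] := df x xx.
split => //; rewrite leNgt; apply/negP => f20.
have [_ df1E] := df1.
have [dd1 _] := df1.
have cv : (fun h : R => h^-1 *: (f1 (h *: 1 + x) - f1 x)) @ 0^' --> f2.
  by rewrite -df1E.
have := cvgr_gt _ cv _ f20 => /(_ (dnbhs_filter _)).
rewrite near_withinE => /nbhs_ballP[e /= e0 he].
pose h := Num.min (e / 2) (d / 2).
have h0 : 0 < h by rewrite lt_min !divr_gt0.
have he2 : h <= e / 2 by rewrite ge_min lexx.
have hd2 : h <= d / 2 by rewrite ge_min lexx orbT.
have f1pos y : x < y -> y < x + h -> 0 < f1 y.
  move=> xy yh; have yx0 : 0 < y - x by lra.
  have := he (y - x); rewrite /ball /= sub0r normrN gtr0_norm //.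
  have ye : y - x < e by lra.
  move=> /(_ ye); rewrite gt_eqF // => /(_ isT).
  by rewrite /GRing.scale /= mulr1 subrK f1x0 subr0 pmulr_rgt0 // invr_gt0.
have xh : x < x + h by lra.
have [||c cI fE] := @MVT R f f1 x (x + h) xh.
- move=> y; rewrite in_itv /= => /andP[? ?]; apply: df.
  by rewrite ltr_norml; apply/andP; split; lra.
- apply: continuous_in_subspaceT => y /set_mem /=; rewrite in_itv /= => /andP[? ?].
  apply: is_derive_continuous; apply: df.
  by rewrite ltr_norml; apply/andP; split; lra.
move: cI; rewrite in_itv /= => /andP[xc ch].
have := fmax (x + h); rewrite addrAC subrr add0r gtr0_norm //.
have hd : h < d by lra.
move=> /(_ hd); rewrite -subr_le0 fE addrAC subrr add0r leNgt mulr_gt0 //.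
exact: f1pos.
Qed.

End calculus.

Section maximum_principle.
Context {R : realType}.
Implicit Types (N v : R -> R -> R) (K : set (R * R)).

(** The last inequality says that the Laplacian of [ln N], multiplied by
    [N ^+ 2], is nonnegative; it is all that is used of the squared modulus of a
    holomorphic function. *)
Definition log_subharmonic N : Prop :=
  exists Ns Nss Nt Ntt : R -> R -> R,
  [/\ forall s t, 0 <= N s t,
      continuous (fun p : R * R => N p.1 p.2),
      forall s t, is_derive s (1 : R) (N ^~ t) (Ns s t) /\
                  is_derive s (1 : R) (Ns ^~ t) (Nss s t),
      forall s t, is_derive t (1 : R) (N s) (Nt s t) /\
                  is_derive t (1 : R) (Nt s) (Ntt s t) &
      forall s t, Ns s t ^+ 2 + Nt s t ^+ 2 <= N s t * (Nss s t + Ntt s t)].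

(** A cross instead of a ball: only second derivatives in the two coordinate
    directions enter the maximum principle. *)
Definition cross_interior K (s t : R) : Prop :=
  exists2 d, 0 < d & forall h, `|h| < d -> K (s + h, t) /\ K (s, t + h).

(** At a maximum of [n e^-v] the first-order condition [n' = v' n] removes [v']
    from the second-order one. *)
Lemma second_derive_max_expR (n n1 v v1 : R -> R) (x n2 v2 d : R) :
  0 < d -> 0 <= n x ->
  (forall y, `|y - x| < d -> is_derive y 1 n (n1 y)) -> is_derive x 1 n1 n2 ->
  (forall y, `|y - x| < d -> is_derive y 1 v (v1 y)) -> is_derive x 1 v1 v2 ->
  (forall y, `|y - x| < d -> n y * expR (- v y) <= n x * expR (- v x)) ->
  n x * n2 <= n1 x ^+ 2 + v2 * n x ^+ 2.
Proof.
move=> d0 n0 dn dn1 dv dv1 nmax.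
have xx : `|x - x| < d by rewrite subrr normr0.
have dE (y e : R) : is_derive y 1 v e ->
    is_derive y 1 (fun z => expR (- v z)) (- e * expR (- v y)).
  move=> dvy; have dN : is_derive y 1 (fun z => - v z) (- e) := is_deriveN dvy.
  apply: (is_derive_eq (@is_derive1_comp R expR (fun z => - v z) y _ _ (is_derive_expR (- v y)) dN)).
  by rewrite mulrC.
have dP (y : R) : `|y - x| < d -> is_derive y 1 (fun z => n z * expR (- v z))
    ((n1 y - v1 y * n y) * expR (- v y)).
  move=> yd; apply: (is_derive_eq (is_deriveM (dn y yd) (dE _ _ (dv y yd)))).
  by rewrite /GRing.scale /=; ring.
have dP1 : is_derive x 1 (fun z => (n1 z - v1 z * n z) * expR (- v z))
    ((n2 - v2 * n x - v1 x * n1 x - v1 x * (n1 x - v1 x * n x)) * expR (- v x)).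
  apply: (is_derive_eq (is_deriveM (is_deriveB dn1
    (is_deriveM dv1 (dn x xx))) (dE _ _ (dv x xx)))).
  by rewrite !fctE /GRing.scale /=; ring.
have [P1 P2] := second_derive_max d0 dP dP1 nmax.
have e0 : 0 < expR (- v x) := expR_gt0 _.
move/eqP: P1; rewrite mulf_eq0 (gt_eqF e0) orbF subr_eq0 => /eqP P1.
move: P2; rewrite pmulr_lle0 // P1 subrr mulr0 subr0 => P2.
rewrite -subr_ge0.
have -> : (v1 x * n x) ^+ 2 + v2 * n x ^+ 2 - n x * n2 =
  n x * - (n2 - v2 * n x - v1 x * (v1 x * n x)) by ring.
by rewrite mulr_ge0 // oppr_ge0.
Qed.

(** At a maximum of [N e^-v] away from the boundary, the inequalities of
    [second_derive_max_expR] in the two coordinate directions add up to a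
    contradiction between the subharmonicity of [ln N] and the strict
    superharmonicity of [v]. *)
Lemma maximum_principle_strict N v vs vss vt vtt K :
  log_subharmonic N -> compact K ->
  (forall s t, K (s, t) -> {for (s, t), continuous (fun p : R * R => v p.1 p.2)}) ->
  (forall s t, K (s, t) -> is_derive s (1 : R) (v ^~ t) (vs s t) /\
     is_derive s (1 : R) (vs ^~ t) (vss s t)) ->
  (forall s t, K (s, t) -> is_derive t (1 : R) (v s) (vt s t) /\
     is_derive t (1 : R) (vt s) (vtt s t)) ->
  (forall s t, K (s, t) -> vss s t + vtt s t < 0) ->
  (forall s t, K (s, t) -> cross_interior K s t \/ N s t <= expR (v s t)) ->
  forall s t, K (s, t) -> N s t <= expR (v s t).
Proof.
move=> [Ns [Nss [Nt [Ntt [N0 cN dNs dNt NL]]]]] cK cv dvs dvt vneg bK s t Kst.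
pose P (p : R * R) := N p.1 p.2 * expR (- v p.1 p.2).
have [] := @compact_EVT_max (R * R)%type R P K.
- by exists (s, t).
- exact: cK.
- apply: continuous_in_subspaceT => -[a b] /set_mem Kab.
  apply: (@continuousM R (R * R)%type (fun p => N p.1 p.2)
    (fun p => expR (- v p.1 p.2))); first exact: cN.
  apply: (@continuous_comp _ _ _ (fun p : R * R => - v p.1 p.2) expR).
    by apply: (@continuousN R^o); exact: cv.
  exact: continuous_expR.
move=> [a b] /set_mem Kab Pmax.
suff Pab : P (a, b) <= 1.
  have := le_trans (Pmax (s, t) (mem_set Kst)) Pab.
  by rewrite /P /= expRN ler_pdivrMr ?expR_gt0 // mul1r.
have [[d d0 dK]|] := bK a b Kab; last first.
  by rewrite /P /= expRN ler_pdivrMr ?expR_gt0 // mul1r.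
rewrite leNgt; apply/negP => P1.
have Nab : 0 < N a b.
  by have := lt_trans ltr01 P1; rewrite /P /= pmulr_lgt0 // expR_gt0.
have Ky y : `|y - a| < d -> K (y, b).
  by move=> /dK[]; rewrite addrC subrK.
have Ky' y : `|y - b| < d -> K (a, y).
  by move=> /dK[_]; rewrite addrC subrK.
have aa : `|a - a| < d by rewrite subrr normr0.
have hs := @second_derive_max_expR (N ^~ b) (Ns ^~ b) (v ^~ b) (vs ^~ b) a
  (Nss a b) (vss a b) d d0 (N0 a b) (fun y _ => (dNs y b).1) (dNs a b).2
  (fun y yd => (dvs y b (Ky y yd)).1) (dvs a b Kab).2
  (fun y yd => Pmax (y, b) (mem_set (Ky y yd))).
have ht := @second_derive_max_expR (N a) (Nt a) (v a) (vt a) b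
  (Ntt a b) (vtt a b) d d0 (N0 a b) (fun y _ => (dNt a y).1) (dNt a b).2
  (fun y yd => (dvt a y (Ky' y yd)).1) (dvt a b Kab).2
  (fun y yd => Pmax (a, y) (mem_set (Ky' y yd))).
have := NL a b; have := vneg a b Kab.
have : 0 < N a b ^+ 2 by rewrite exprn_gt0.
by move: hs ht => /=; nra.
Qed.

(** Comparison with a superharmonic function: [v] is perturbed to a strictly
    superharmonic one by a small multiple of a concave quadratic. *)
Lemma maximum_principle N v vs vss vt vtt K :
  log_subharmonic N -> compact K ->
  (forall s t, K (s, t) -> {for (s, t), continuous (fun p : R * R => v p.1 p.2)}) ->
  (forall s t, K (s, t) -> is_derive s (1 : R) (v ^~ t) (vs s t) /\
     is_derive s (1 : R) (vs ^~ t) (vss s t)) ->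
  (forall s t, K (s, t) -> is_derive t (1 : R) (v s) (vt s t) /\
     is_derive t (1 : R) (vt s) (vtt s t)) ->
  (forall s t, K (s, t) -> vss s t + vtt s t <= 0) ->
  (forall s t, K (s, t) -> cross_interior K s t \/ N s t <= expR (v s t)) ->
  forall s t, K (s, t) -> N s t <= expR (v s t).
Proof.
move=> hN cK cv dvs dvt vneg bK s t Kst.
have [B hB] : exists B, forall p : R * R, K p -> p.1 ^+ 2 <= B.
  have [|||c _ cmax] := @compact_EVT_max (R * R)%type R (fun p => p.1 ^+ 2) K.
  - by exists (s, t).
  - exact: cK.
  - apply: continuous_in_subspaceT => p _.
    apply: (@continuous_comp _ _ _ (fun p : R * R => p.1) (fun x => x ^+ 2)).
      exact: cvg_fst.
    exact: exprn_continuous.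
  by exists (c.1 ^+ 2) => p Kp; apply: cmax; exact: mem_set.
apply: (@ler_expR_eps _ _ _ (B - s ^+ 2)); first exact: expR_ge0.
move=> e e0; rewrite -expRD.
pose w s t := v s t + e * (B - s ^+ 2).
apply: (@maximum_principle_strict N w (fun s t => vs s t - 2 * e * s)
  (fun s t => vss s t - 2 * e) vt vtt K) => //.
- move=> a b Kab.
  apply: (@continuousD R R^o (R * R)%type (fun p => v p.1 p.2)); first exact: cv.
  apply: (@continuous_comp _ _ _ (fun p : R * R => p.1)
    (fun x => e * (B - x ^+ 2))); first exact: cvg_fst.
  apply: (@continuousM R R^o (fun=> e)); first exact: cvg_cst.
  apply: (@continuousB R R^o R^o (fun=> B)); first exact: cvg_cst.
  exact: exprn_continuous.
- move=> a b Kab; have [d1 d2] := dvs a b Kab; split.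
    apply: (is_derive_eq (is_deriveD d1 (is_deriveZ e (is_deriveB
      (is_derive_cst B a 1) (is_deriveX 2 (is_derive_id a 1)))))).
    by rewrite /GRing.scale /=; ring.
  apply: (is_derive_eq (is_deriveB d2 (is_deriveZ (2 * e) (is_derive_id a 1)))).
  by rewrite /GRing.scale /=; ring.
- move=> a b Kab; have [d1 d2] := dvt a b Kab; split => //.
  apply: (is_derive_eq (is_deriveD d1 (is_derive_cst (e * (B - a ^+ 2)) b 1))).
  by rewrite addr0.
- by move=> a b Kab; have := vneg a b Kab; lra.
- move=> a b Kab; have [|h] := bK a b Kab; [by left|right].
  apply: (le_trans h); rewrite ler_expR lerDl mulr_ge0 ?(ltW e0) // subr_ge0.
  exact: (hB (a, b)).
Qed.

End maximum_principle.

(** * The Phragmen-Lindelof principle *)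

Section plane.
Context {R : realType}.
Implicit Types (f g : R * R -> R) (p : R * R).

Lemma continuous_fst p : {for p, continuous (fun p : R * R => p.1)}.
Proof. exact: cvg_fst. Qed.

Lemma continuous_snd p : {for p, continuous (fun p : R * R => p.2)}.
Proof. exact: cvg_snd. Qed.

Lemma continuous_cst2 c p : {for p, continuous (fun _ : R * R => c : R)}.
Proof. exact: cvg_cst. Qed.

Lemma continuousD2 f g p : {for p, continuous f} -> {for p, continuous g} ->
  {for p, continuous (fun p => f p + g p)}.
Proof. by move=> cf cg; apply: (@continuousD R R^o (R * R)%type f g). Qed.

Lemma continuousB2 f g p : {for p, continuous f} -> {for p, continuous g} ->
  {for p, continuous (fun p => f p - g p)}.
Proof. by move=> cf cg; apply: (@continuousB R R^o (R * R)%type f g). Qed.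

Lemma continuousM2 f g p : {for p, continuous f} -> {for p, continuous g} ->
  {for p, continuous (fun p => f p * g p)}.
Proof. by move=> cf cg; apply: (@continuousM R (R * R)%type f g). Qed.

Lemma continuous_comp2 (h : R -> R) f p : {for p, continuous f} ->
  {for f p, continuous h} -> {for p, continuous (fun p => h (f p))}.
Proof. by move=> cf ch; apply: (@continuous_comp _ _ _ f h). Qed.

Lemma closed_ge0 f : (forall p, {for p, continuous f}) ->
  closed [set p | 0 <= f p].
Proof.
by move=> cf; apply: (@preimage_closed _ _ f [set x | 0 <= x]) => [p _|];
  [exact: cf|exact: closed_ge].
Qed.

Lemma compact_bounded_closed (K : set (R * R)) (B : R) : closed K ->
  (forall s t, K (s, t) -> `|s| <= B /\ `|t| <= B) -> compact K.
Proof.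
move=> clK bK; apply: (@subclosed_compact _ _ (`[- B, B] `*` `[- B, B])) => //.
  by apply: compact_setX; exact: segment_compact.
by move=> [s t] /bK[]; rewrite !ler_norml => ? ?; split; rewrite /= in_itv.
Qed.

Lemma is_derive_quadratic (a b c x : R) :
  is_derive x (1 : R) (fun s : R => a * s ^+ 2 + b * s + c) (2 * a * x + b).
Proof.
apply: (is_derive_eq (is_deriveD (is_deriveD
  (is_deriveZ a (is_deriveX 2 (is_derive_id x 1)))
  (is_deriveZ b (is_derive_id x 1))) (is_derive_cst c x 1))).
by rewrite /GRing.scale /=; ring.
Qed.

End plane.

Section phragmen_lindelof.
Context {R : realType}.
Variables (N : R -> R -> R) (D l : R).
Hypotheses (hN : log_subharmonic N) (D0 : 0 < D) (l0 : 0 < l).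
Hypothesis N_le : forall s t, N s t <= D * expR (2 * l * s ^+ 2).
Hypothesis N_le0 : forall t, N 0 t <= D * expR (- (2 * l * t ^+ 2)).

(** The sector [0 <= s], [k s <= t] is narrower than a quarter turn, which leaves
    room for a barrier that grows faster than the quadratic exponents of [N]:
    the form [q] has Laplacian [-2] and dominates [t ^+ 2] on the sector, its
    product with [ln (M + t)] is superquadratic, and [M] is so large that the
    product remains superharmonic. *)
Section sector.
Variable k : R.
Hypothesis k0 : 0 < k.
Let m := 2 / k.
Let M := expR (2 + m / k).
Let q (s t : R) := t ^+ 2 + m * s * t - 2 * s ^+ 2.
Let v (e s t : R) := ln D + 2 * l * (s ^+ 2 - t ^+ 2) + 2 * l * k * s * t
  + e * (q s t * ln (M + t)).

Let m0 : 0 < m. Proof. by rewrite divr_gt0. Qed.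
Let mk : m * k = 2. Proof. by rewrite /m divfK // gt_eqF. Qed.
Let M0 : 0 < M. Proof. exact: expR_gt0. Qed.

Let q_ge s t : 0 <= s -> k * s <= t -> t ^+ 2 <= q s t.
Proof.
move=> s0 kst; rewrite /q -addrA lerDl subr_ge0.
have -> : 2 * s ^+ 2 = m * s * (k * s) by rewrite -mk; ring.
by rewrite ler_wpM2l // mulr_ge0 // ltW.
Qed.

Let lnM t : 0 <= t -> 2 + m / k <= ln (M + t).
Proof.
move=> t0; rewrite -[leLHS]expRK ler_ln ?posrE // ?ler_wpDr //.
by rewrite ltr_wpDr.
Qed.

Let sector_le_truncated (e r s t : R) : 0 < e -> 2 * l <= e * ln (M + r) ->
  0 <= s -> k * s <= t -> t <= r -> N s t <= expR (v e s t).
Proof.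
move=> e0 hr.
pose K : set (R * R) := [set p | 0 <= p.1] `&` [set p | 0 <= p.2 - k * p.1]
  `&` [set p | 0 <= r - p.2].
have KE a b : K (a, b) <-> [/\ 0 <= a, k * a <= b & b <= r].
  by split => [[[/= ? ?] ?]|[? ? ?]]; [split|split; [split|]] => /=; lra.
move=> s0 kst tr.
have b0 a b : K (a, b) -> 0 <= b.
  by move=> /KE[a0 ka _]; apply: le_trans ka; rewrite mulr_ge0 // ltW.
have Mb a b : K (a, b) -> 0 < M + b by move=> /b0; move: M0; lra.
pose q2 (s t : R) := 2 * t + m * s.
apply: (@maximum_principle R N (v e)
  (fun s t => 4 * l * s + 2 * l * k * t + e * ((m * t - 4 * s) * ln (M + t)))
  (fun s t => 4 * l - e * (4 * ln (M + t)))
  (fun s t => - 4 * l * t + 2 * l * k * s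
     + e * (q2 s t * ln (M + t) + q s t / (M + t)))
  (fun s t => - 4 * l + e * (2 * ln (M + t) + 2 * (q2 s t / (M + t))
     - q s t / (M + t) ^+ 2)) K hN); last by apply/KE.
- apply: (@compact_bounded_closed R K (r + r / k)).
    apply: closedI; first apply: closedI; apply: closed_ge0 => p.
    + exact: continuous_fst.
    + apply: continuousB2; first exact: continuous_snd.
      by apply: continuousM2; [exact: continuous_cst2|exact: continuous_fst].
    + by apply: continuousB2; [exact: continuous_cst2|exact: continuous_snd].
  move=> a b Kab; have bp := b0 _ _ Kab; move/KE: Kab => [a0 kab br].
  have rk : a <= r / k by rewrite ler_pdivlMr // mulrC; lra.
  have rk0 : 0 <= r / k by lra.
  by rewrite !ger0_norm //; split; lra.
- move=> a b Kab; have Mb0 := Mb _ _ Kab.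
  have c1 := @continuous_fst R (a, b); have c2 := @continuous_snd R (a, b).
  have cc c := @continuous_cst2 R c (a, b).
  have cX (f : R * R -> R) : {for (a, b), continuous f} ->
      {for (a, b), continuous (fun p : R * R => f p ^+ 2 : R)}.
    move=> cf; apply: (@continuous_comp2 R (fun x => x ^+ 2)) => //.
    exact: exprn_continuous.
  rewrite /v /q.
  apply: continuousD2; first apply: continuousD2; first apply: continuousD2.
  + exact: cc.
  + by apply: continuousM2; [exact: cc|apply: continuousB2; exact: cX].
  + apply: continuousM2 => //; apply: continuousM2 => //; exact: cc.
  + apply: continuousM2; first exact: cc.
    apply: continuousM2.
      apply: continuousB2; first apply: continuousD2; first exact: cX.
        by apply: continuousM2 => //; apply: continuousM2 => //; exact: cc.
      by apply: continuousM2; [exact: cc|exact: cX].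
    apply: (@continuous_comp2 R (@ln R)); last exact: continuous_ln.
    by apply: continuousD2 => //; exact: cc.
- move=> a b Kab; split.
    have := is_derive_quadratic (2 * l - 2 * e * ln (M + b))
      (2 * l * k * b + e * m * b * ln (M + b))
      (ln D - 2 * l * b ^+ 2 + e * b ^+ 2 * ln (M + b)) a.
    rewrite (_ : (fun s : R => _) = v e ^~ b); last first.
      by apply/funext => x; rewrite /v /q; ring.
    by move/is_derive_eq; apply; ring.
  have := is_derive_quadratic 0 (4 * l - 4 * e * ln (M + b))
      (2 * l * k * b + e * m * b * ln (M + b)) a.
  rewrite (_ : (fun s : R => _) = (fun s => 4 * l * s + 2 * l * k * b +
      e * ((m * b - 4 * s) * ln (M + b)))); last first.
    by apply/funext => x; ring.
  by move/is_derive_eq; apply; ring.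
- move=> a b Kab; have Mb0 := Mb _ _ Kab.
  have dlin : is_derive b (1 : R) (fun t => M + t) 1.
    by apply: (is_derive_eq (is_deriveD (is_derive_cst M b 1) (is_derive_id b 1)));
       rewrite add0r.
  have dln : is_derive b (1 : R) (fun t => ln (M + t)) (M + b)^-1.
    apply: (is_derive_eq (@is_derive1_comp R (@ln R) (fun t => M + t) b _ _
      (is_derive1_ln Mb0) dlin)).
    by rewrite mulr1.
  have dinv : is_derive b (1 : R) (fun t => (M + t)^-1) (- (M + b) ^- 2).
    have Mbn0 : M + b != 0 by rewrite gt_eqF.
    apply: (is_derive_eq (is_deriveV Mbn0 dlin)).
    by rewrite /GRing.scale /= mulr1.
  have dq : is_derive b (1 : R) (fun t => q a t) (q2 a b).
    have := is_derive_quadratic 1 (m * a) (- (2 * a ^+ 2)) b.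
    rewrite (_ : (fun t : R => _) = q a); last first.
      by apply/funext => x; rewrite /q; ring.
    by move/is_derive_eq; apply; rewrite /q2; ring.
  have dq2 : is_derive b (1 : R) (fun t => q2 a t) 2.
    have := is_derive_quadratic 0 2 (m * a) b.
    rewrite (_ : (fun t : R => _) = q2 a); last first.
      by apply/funext => x; rewrite /q2; ring.
    by move/is_derive_eq; apply; ring.
  split.
    have := is_deriveD (is_derive_quadratic (- (2 * l)) (2 * l * k * a)
      (ln D + 2 * l * a ^+ 2) b) (is_deriveZ e (is_deriveM dq dln)).
    rewrite (_ : (_ + _) = v e a); last first.
      apply/funext => x; rewrite /v !fctE /= /GRing.scale /=; ring.
    by move/is_derive_eq; apply; rewrite /GRing.scale /=; ring.
  have := is_deriveD (is_derive_quadratic 0 (- 4 * l) (2 * l * k * a) b)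
    (is_deriveZ e (is_deriveD (is_deriveM dq2 dln) (is_deriveM dq dinv))).
  rewrite (_ : (_ + _) = (fun t => - 4 * l * t + 2 * l * k * a
     + e * (q2 a t * ln (M + t) + q a t / (M + t)))); last first.
    by apply/funext => x; rewrite !fctE /= /GRing.scale /=; ring.
  by move/is_derive_eq; apply; rewrite /GRing.scale /= -exprVn; ring.
- move=> a b Kab; have Mb0 := Mb _ _ Kab; have b_ge0 := b0 _ _ Kab.
  move/KE: Kab => [a0 kab br].
  cbv beta; rewrite [leLHS](_ : _ = - e * (2 * ln (M + b) - 2 * (q2 a b / (M + b))
    + q a b / (M + b) ^+ 2)); last by ring.
  rewrite mulNr oppr_le0 mulr_ge0 ?(ltW e0) // addr_ge0 //; last first.
    by rewrite divr_ge0 ?sqr_ge0 // (le_trans _ (q_ge a0 kab)) ?sqr_ge0.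
  rewrite -mulrBr mulr_ge0 // subr_ge0 (le_trans _ (lnM b_ge0)) //.
  rewrite ler_pdivrMr // /q2.
  have mk0 : 0 <= m / k by rewrite divr_ge0 // ltW.
  have h1 : m * a <= m / k * b.
    by rewrite -mulrA ler_wpM2l ?(ltW m0) // mulrC ler_pdivlMr // mulrC.
  have h2 : 0 <= (2 + m / k) * M by rewrite mulr_ge0 ?(ltW M0) // addr_ge0.
  rewrite mulrDr; apply: (@le_trans _ _ ((2 + m / k) * b)); last by lra.
  by rewrite mulrDl; lra.
- move=> a b Kab; have b_ge0 := b0 _ _ Kab; move/KE: (Kab) => [a0 kab br].
  have q0 : 0 <= q a b by rewrite (le_trans _ (q_ge a0 kab)) ?sqr_ge0.
  have L0 : 0 <= ln (M + b).
    by rewrite (le_trans _ (lnM b_ge0)) // addr_ge0 // divr_ge0 // ltW.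
  have eqL : 0 <= e * (q a b * ln (M + b)) by rewrite mulr_ge0 ?mulr_ge0 // ltW.
  have vD x y : x <= y -> D * expR x <= expR (ln D + y).
    by move=> xy; rewrite expRD lnK ?posrE // ler_wpM2l ?(ltW D0) // ler_expR.
  have [aE|an0] := eqVneq a 0.
    right; apply: (le_trans (y := D * expR (- (2 * l * b ^+ 2)))).
      by rewrite aE; exact: N_le0.
    by rewrite /v -!addrA; apply: vD; rewrite aE; move: eqL; rewrite aE; lra.
  have [bE|bn] := eqVneq (k * a) b.
    right; apply: (le_trans (N_le _ _)); rewrite /v -!addrA; apply: vD.
    have -> : 2 * l * k * a * b = 2 * l * b ^+ 2 by rewrite -bE; ring.
    by move: eqL; lra.
  have [bE|bnr] := eqVneq b r.
    right; apply: (le_trans (N_le _ _)); rewrite /v -!addrA; apply: vD.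
    have : 0 <= 2 * l * k * a * b by rewrite !mulr_ge0 // ltW.
    have : 2 * l * b ^+ 2 <= e * (q a b * ln (M + b)).
      have -> : e * (q a b * ln (M + b)) = e * ln (M + b) * q a b by ring.
      apply: ler_pM; [by rewrite mulr_ge0 // ltW|exact: sqr_ge0| |exact: q_ge].
      by rewrite bE.
    lra.
  (* [a] and [b] move by [h] separately, and [b - k a] by at most [(1 + k) h]. *)
  left; have a_gt0 : 0 < a by rewrite lt_neqAle eq_sym an0.
  have kab' : k * a < b by rewrite lt_neqAle bn.
  have br' : b < r by rewrite lt_neqAle bnr.
  pose d := Num.min a (Num.min ((b - k * a) / (1 + k)) (r - b)).
  have k1 : 0 < 1 + k by rewrite addr_gt0.
  exists d; first by rewrite !lt_min a_gt0 divr_gt0 ?subr_gt0.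
  move=> h; rewrite !lt_min => /and3P[ha hb hr'].
  move: hb; rewrite ltr_pdivlMr // => hb.
  have [h1 h2] : h <= `|h| /\ - h <= `|h| by rewrite ler_norm -normrN ler_norm.
  have h0 := normr_ge0 h.
  have hk : k * `|h| <= b - k * a.
    by rewrite (le_trans _ (ltW hb)) // mulrDr mulr1 mulrC lerDr.
  have hk' : k * h <= k * `|h| by rewrite ler_wpM2l // ltW.
  have kh0 : 0 <= k * `|h| by rewrite mulr_ge0 // ltW.
  have hb' : `|h| <= b - k * a.
    by rewrite (le_trans _ (ltW hb)) // mulrDr mulr1 lerDl mulr_ge0 // ltW.
  by split; apply/KE; split; lra.
Qed.

(** Between the sector and the real axis the bound follows from the growth
    assumption alone; in the sector the truncation is sent to infinity and the
    barrier to zero. *)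
Lemma sector_le s t : 0 <= s -> 0 <= t ->
  N s t <= D * expR (2 * l * (s ^+ 2 - t ^+ 2)) * expR (k * (2 * l * (s * t))).
Proof.
move=> s0 t0; have [kst|tks] := leP (k * s) t; last first.
  apply: (le_trans (N_le _ _)); rewrite -[leRHS]mulrA -expRD ler_wpM2l ?(ltW D0) //.
  rewrite ler_expR; have : t * t <= k * s * t by rewrite ler_wpM2r // ltW.
  move=> h; have : 2 * l * (t * t) <= 2 * l * (k * s * t).
    by rewrite ler_wpM2l // mulr_ge0 // ltW.
  lra.
apply: (@ler_expR_eps R _ _ (q s t * ln (M + t))).
  by rewrite !mulr_ge0 ?expR_ge0 // ltW.
move=> e e0; pose r := Num.max t (expR (2 * l / e)).
have tr : t <= r by rewrite le_max lexx.
have hr : 2 * l <= e * ln (M + r).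
  rewrite [leRHS]mulrC -ler_pdivrMr // -[leLHS]expRK ler_ln ?posrE ?expR_gt0 //.
    by rewrite ler_wpDl ?(ltW M0) // le_max lexx orbT.
  by rewrite ltr_wpDr // (le_trans t0).
apply: le_trans (sector_le_truncated e0 hr s0 kst tr) _.
rewrite /v 3!expRD lnK ?posrE //.
have -> : 2 * l * k * s * t = k * (2 * l * (s * t)) by ring.
exact: lexx.
Qed.

End sector.

(** Letting the opening of the sector tend to a quarter turn. *)
Lemma quadrant_le s t : 0 <= s -> 0 <= t ->
  N s t <= D * expR (2 * l * (s ^+ 2 - t ^+ 2)).
Proof.
move=> s0 t0; apply: (@ler_expR_eps R _ _ (2 * l * (s * t))).
  by rewrite mulr_ge0 ?expR_ge0 // ltW.
by move=> k k0; exact: sector_le.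
Qed.

End phragmen_lindelof.

Section reflections.
Context {R : realType}.
Implicit Types N : R -> R -> R.

Lemma is_derive_reflect (f : R -> R) (x d : R) : is_derive (- x) 1 f d ->
  is_derive x (1 : R) (fun y : R => f (- y)) (- d).
Proof.
move=> df; apply: (is_derive_eq (@is_derive1_comp R f (fun y => - y) x _ _ df
  (is_deriveN (is_derive_id x 1)))).
by rewrite mulrN1.
Qed.

Lemma log_subharmonic_reflect_fst N : log_subharmonic N ->
  log_subharmonic (fun s t => N (- s) t).
Proof.
move=> [Ns [Nss [Nt [Ntt [N0 cN dNs dNt NL]]]]].
exists (fun s t => - Ns (- s) t), (fun s t => Nss (- s) t),
  (fun s t => Nt (- s) t), (fun s t => Ntt (- s) t); split.
- by move=> s t; exact: N0.
- move=> p; apply: (@continuous_comp _ _ _ (fun p : R * R => (- p.1, p.2))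
    (fun p => N p.1 p.2)); last exact: cN.
  apply: (@cvg_pair _ _ _ _ (nbhs (- p.1)) (nbhs p.2) _ _ _ (fun p : R * R => - p.1) snd).
    by apply: (@continuousN R R^o); exact: continuous_fst.
  exact: continuous_snd.
- move=> s t; have [d1 d2] := dNs (- s) t; split.
    exact: (is_derive_reflect d1).
  apply: (is_derive_eq (is_deriveN (is_derive_reflect d2))).
  by rewrite opprK.
- by move=> s t; have [d1 d2] := dNt (- s) t.
- by move=> s t; rewrite sqrrN; exact: NL.
Qed.

Lemma log_subharmonic_reflect_snd N : log_subharmonic N ->
  log_subharmonic (fun s t => N s (- t)).
Proof.
move=> [Ns [Nss [Nt [Ntt [N0 cN dNs dNt NL]]]]].
exists (fun s t => Ns s (- t)), (fun s t => Nss s (- t)),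
  (fun s t => - Nt s (- t)), (fun s t => Ntt s (- t)); split.
- by move=> s t; exact: N0.
- move=> p; apply: (@continuous_comp _ _ _ (fun p : R * R => (p.1, - p.2))
    (fun p => N p.1 p.2)); last exact: cN.
  apply: (@cvg_pair _ _ _ _ (nbhs p.1) (nbhs (- p.2)) _ _ _ fst (fun p : R * R => - p.2)).
    exact: continuous_fst.
  by apply: (@continuousN R R^o); exact: continuous_snd.
- by move=> s t; have [d1 d2] := dNs s (- t).
- move=> s t; have [d1 d2] := dNt s (- t); split.
    exact: (is_derive_reflect d1).
  apply: (is_derive_eq (is_deriveN (is_derive_reflect d2))).
  by rewrite opprK.
- by move=> s t; rewrite sqrrN; exact: NL.
Qed.

(** The four quadrants are exchanged by the reflections in the axes, which
    preserve the hypotheses. *)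
Lemma phragmen_lindelof N (D l : R) : log_subharmonic N -> 0 < D -> 0 < l ->
  (forall s t, N s t <= D * expR (2 * l * s ^+ 2)) ->
  (forall t, N 0 t <= D * expR (- (2 * l * t ^+ 2))) ->
  forall s t, N s t <= D * expR (2 * l * (s ^+ 2 - t ^+ 2)).
Proof.
move=> hN D0 l0 h1 h2 s t.
have half N' s' t' : log_subharmonic N' ->
    (forall s t, N' s t <= D * expR (2 * l * s ^+ 2)) ->
    (forall t, N' 0 t <= D * expR (- (2 * l * t ^+ 2))) ->
    0 <= t' -> N' s' t' <= D * expR (2 * l * (s' ^+ 2 - t' ^+ 2)).
  move=> hN' h1' h2' t0; have [s0|s0] := leP 0 s'; first exact: quadrant_le.
  have := @quadrant_le R (fun s t => N' (- s) t) D l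
    (log_subharmonic_reflect_fst hN') D0 l0 _ _ (- s') t' _ t0.
  rewrite opprK sqrrN; apply.
  - by move=> a b; rewrite -(sqrrN a).
  - by move=> b; rewrite oppr0.
  - by rewrite oppr_ge0 ltW.
have [t0|t0] := leP 0 t; first exact: half.
have := half (fun a b => N a (- b)) s (- t) (log_subharmonic_reflect_snd hN).
rewrite opprK sqrrN; apply.
- by move=> a b; exact: h1.
- by move=> b; rewrite -(sqrrN b); exact: h2.
- by rewrite oppr_ge0 ltW.
Qed.

End reflections.

(** * Liouville's theorem *)

Section liouville.
Context {R : realType}.
Implicit Types N : R -> R -> R.

Let is_derive_ln_sqrD (c x : R) : 0 < x ^+ 2 + c ->
  is_derive x (1 : R) (fun y => ln (y ^+ 2 + c)) (2 * x / (x ^+ 2 + c)) /\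
  is_derive x (1 : R) (fun y => 2 * y / (y ^+ 2 + c))
    (2 / (x ^+ 2 + c) - 4 * x ^+ 2 / (x ^+ 2 + c) ^+ 2).
Proof.
move=> xc; have xcn : x ^+ 2 + c != 0 by rewrite gt_eqF.
have dq : is_derive x (1 : R) (fun y => y ^+ 2 + c) (2 * x).
  have := is_derive_quadratic 1 0 c x.
  rewrite (_ : (fun s : R => _) = (fun y => y ^+ 2 + c)); last first.
    by apply/funext => y; ring.
  by move/is_derive_eq; apply; ring.
split.
  apply: (is_derive_eq (@is_derive1_comp R (@ln R) (fun y => y ^+ 2 + c) x _ _
      (is_derive1_ln xc) dq)).
  by rewrite mulrC.
have dV : is_derive x (1 : R) (fun y => (y ^+ 2 + c)^-1)
    (- (x ^+ 2 + c) ^- 2 * (2 * x)).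
  exact: (@is_deriveV R (fun y : R => y ^+ 2 + c) x (2 * x) 1 xcn dq).
have := is_deriveM (is_deriveZ 2 (is_derive_id x 1)) dV.
rewrite (_ : (_ * _) = (fun y => 2 * y / (y ^+ 2 + c))); last first.
  by apply/funext => y.
move/is_derive_eq; apply; rewrite /= /GRing.scale /=.
by field.
Qed.

(** The logarithm of the right-hand side is harmonic off the origin. On an annulus
    of inner radius [E ^ (1/2)] the inequality holds on the inner circle by
    assumption, and on the outer one as soon as its radius is so large that the
    last factor exceeds [D / eta]. *)
Lemma annulus_le N (D l eta E m s t : R) : log_subharmonic N -> 0 < D ->
  0 < eta -> 0 < E -> 0 < m ->
  (forall s t, N s t <= D * expR (2 * l * (s ^+ 2 - t ^+ 2))) ->
  (forall s t, s ^+ 2 + t ^+ 2 <= E ->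
     N s t <= eta * expR (2 * l * (s ^+ 2 - t ^+ 2))) ->
  E <= s ^+ 2 + t ^+ 2 ->
  N s t <= eta * expR (2 * l * (s ^+ 2 - t ^+ 2)) *
           expR (m * ln ((s ^+ 2 + t ^+ 2) / E)).
Proof.
move=> hN D0 eta0 E0 m0 N_le N_small Est.
pose P := Num.max (s ^+ 2 + t ^+ 2) (E * expR (ln (D / eta) / m)).
pose K : set (R * R) := [set p | 0 <= p.1 ^+ 2 + p.2 ^+ 2 - E] `&`
  [set p | 0 <= P - (p.1 ^+ 2 + p.2 ^+ 2)].
pose v a b := ln eta - m * ln E + 2 * l * (a ^+ 2 - b ^+ 2)
  + m * ln (a ^+ 2 + b ^+ 2).
have KE a b : K (a, b) <-> E <= a ^+ 2 + b ^+ 2 <= P.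
  split => [[/= ? ?]|/andP[? ?]]; last by split => /=; lra.
  by apply/andP; split; lra.
have r0 a b : K (a, b) -> 0 < a ^+ 2 + b ^+ 2.
  by move=> /KE /andP[]; move: E0; lra.
have vE a b : K (a, b) -> expR (v a b) =
    eta * expR (2 * l * (a ^+ 2 - b ^+ 2)) *
    expR (m * ln ((a ^+ 2 + b ^+ 2) / E)).
  move=> /r0 ab0; rewrite ln_div ?posrE // -[eta in RHS]lnK ?posrE // -!expRD.
  by congr expR; rewrite /v; ring.
have Kst : K (s, t) by apply/KE; rewrite Est le_max lexx.
rewrite -vE //.
have cX (f : R * R -> R) p : {for p, continuous f} ->
    {for p, continuous (fun p : R * R => f p ^+ 2 : R)}.
  move=> cf; apply: (@continuous_comp2 R (fun x => x ^+ 2)) => //.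
  exact: exprn_continuous.
have cr (p : R * R) : {for p, continuous (fun p : R * R => p.1 ^+ 2 + p.2 ^+ 2)}.
  by apply: continuousD2; apply: cX; [exact: continuous_fst|exact: continuous_snd].
apply: (@maximum_principle R N v
  (fun a b => 4 * l * a + m * (2 * a / (a ^+ 2 + b ^+ 2)))
  (fun a b => 4 * l + m * (2 / (a ^+ 2 + b ^+ 2) -
     4 * a ^+ 2 / (a ^+ 2 + b ^+ 2) ^+ 2))
  (fun a b => - 4 * l * b + m * (2 * b / (b ^+ 2 + a ^+ 2)))
  (fun a b => - 4 * l + m * (2 / (b ^+ 2 + a ^+ 2) -
     4 * b ^+ 2 / (b ^+ 2 + a ^+ 2) ^+ 2)) K hN); last exact: Kst.
- apply: (@compact_bounded_closed R K (1 + P)).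
    apply: closedI; apply: closed_ge0 => p.
      by apply: continuousB2 => //; exact: continuous_cst2.
    by apply: continuousB2 => //; exact: continuous_cst2.
  move=> a b /KE /andP[_ abP].
  have ub x y : x ^+ 2 + y ^+ 2 <= P -> `|x| <= 1 + P.
    rewrite -(real_normK (num_real x)); have := normr_ge0 x.
    by have := sqr_ge0 y; nra.
  by split; [apply: (ub a b)|apply: (ub b a); rewrite addrC].
- move=> a b Kab; rewrite /v; have ab0 := r0 _ _ Kab.
  apply: continuousD2; first apply: continuousD2.
  + exact: continuous_cst2.
  + apply: continuousM2; first exact: continuous_cst2.
    by apply: continuousB2; apply: cX; [exact: continuous_fst|exact: continuous_snd].
  + apply: continuousM2; first exact: continuous_cst2.
    by apply: (@continuous_comp2 R (@ln R)); [exact: cr|exact: continuous_ln].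
- move=> a b Kab; have [d1 d2] := is_derive_ln_sqrD (r0 _ _ Kab); split.
    have := is_deriveD (is_derive_quadratic (2 * l) 0
      (ln eta - m * ln E - 2 * l * b ^+ 2) a) (is_deriveZ m d1).
    rewrite (_ : (_ + _) = v ^~ b); last first.
      by apply/funext => y; rewrite !fctE /= /v /GRing.scale /=; ring.
    by move/is_derive_eq; apply; rewrite /GRing.scale /=; ring.
  have := is_deriveD (is_derive_quadratic 0 (4 * l) 0 a) (is_deriveZ m d2).
  rewrite (_ : (_ + _) = (fun a => 4 * l * a + m * (2 * a / (a ^+ 2 + b ^+ 2)))).
    by move/is_derive_eq; apply; rewrite /GRing.scale /=; ring.
  by apply/funext => y; rewrite !fctE /= /GRing.scale /=; ring.
- move=> a b Kab; have ba0 : 0 < b ^+ 2 + a ^+ 2 by rewrite addrC r0.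
  have [d1 d2] := is_derive_ln_sqrD ba0; split.
    have := is_deriveD (is_derive_quadratic (- (2 * l)) 0
      (ln eta - m * ln E + 2 * l * a ^+ 2) b) (is_deriveZ m d1).
    rewrite (_ : (_ + _) = v a); last first.
      apply/funext => y; rewrite !fctE /= /v /GRing.scale /= [a ^+ 2 + y ^+ 2]addrC.
      by ring.
    by move/is_derive_eq; apply; rewrite /GRing.scale /=; ring.
  have := is_deriveD (is_derive_quadratic 0 (- 4 * l) 0 b) (is_deriveZ m d2).
  rewrite (_ : (_ + _) = (fun b => - 4 * l * b + m * (2 * b / (b ^+ 2 + a ^+ 2)))).
    by move/is_derive_eq; apply; rewrite /GRing.scale /=; ring.
  by apply/funext => y; rewrite !fctE /= /GRing.scale /=; ring.
- move=> a b /r0 ab0; cbv beta.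
  rewrite [b ^+ 2 + a ^+ 2]addrC le_eqVlt; apply/orP; left; apply/eqP.
  by field; rewrite gt_eqF.
- move=> a b Kab; rewrite vE //; move/KE: (Kab) => /andP[Eab abP].
  have X1 : 1 <= expR (m * ln ((a ^+ 2 + b ^+ 2) / E)).
    rewrite -[leLHS]expR0 ler_expR mulr_ge0 ?(ltW m0) // ln_ge0 //.
    by rewrite ler_pdivlMr // mul1r.
  have [abE|abE] := leP (a ^+ 2 + b ^+ 2) E.
    right; apply: (le_trans (N_small _ _ abE)).
    by rewrite ler_peMr // mulr_ge0 ?expR_ge0 // ltW.
  have [abP'|abP'] := eqVneq (a ^+ 2 + b ^+ 2) P.
    right; apply: (le_trans (N_le a b)).
    rewrite [leRHS]mulrAC ler_wpM2r ?expR_ge0 // -ler_pdivrMl // mulrC.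
    rewrite -[leLHS]lnK ?posrE ?divr_gt0 // ler_expR -ler_pdivrMl // mulrC.
    rewrite -[leLHS]expRK ler_ln ?posrE ?expR_gt0 ?divr_gt0 ?r0 //.
    rewrite ler_pdivlMr // abP' /P le_max; apply/orP; right.
    by rewrite [leRHS]mulrC [m^-1 * _]mulrC [eta^-1 * _]mulrC.
  left.
  have cn : cross_interior K a b.
    have hP : a ^+ 2 + b ^+ 2 < P by rewrite lt_neqAle abP'.
    pose g := Num.min (a ^+ 2 + b ^+ 2 - E) (P - (a ^+ 2 + b ^+ 2)).
    have g0 : 0 < g by rewrite lt_min !subr_gt0 abE.
    have g1 : g <= a ^+ 2 + b ^+ 2 - E by rewrite ge_min lexx.
    have g2 : g <= P - (a ^+ 2 + b ^+ 2) by rewrite ge_min lexx orbT.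
    pose B := 2 * `|a| + 2 * `|b| + 1.
    have B1 : 1 <= B by rewrite lerDr addr_ge0 // mulr_ge0.
    have B0 : 0 < B by lra.
    exists (Num.min 1 (g / B)); first by rewrite lt_min ltr01 divr_gt0.
    move=> h; rewrite lt_min ltr_pdivlMr // => /andP[h1 hB].
    have key x : 2 * `|x| + 1 <= B -> `|(x + h) ^+ 2 - x ^+ 2| <= g.
      move=> xB; have -> : (x + h) ^+ 2 - x ^+ 2 = h * (2 * x + h) by ring.
      rewrite normrM (le_trans _ (ltW hB)) // ler_wpM2l //.
      apply: (le_trans (ler_normD _ _)); rewrite normrM normr_nat.
      by apply: le_trans xB; rewrite lerD2l ltW.
    have := key a; have := key b; rewrite !ler_norml.
    have hb : 2 * `|b| + 1 <= B by rewrite /B -addrA lerDr mulr_ge0.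
    have ha : 2 * `|a| + 1 <= B by rewrite /B addrAC lerDl mulr_ge0.
    move=> /(_ hb)/andP[? ?] /(_ ha)/andP[? ?].
    by split; apply/KE; apply/andP; split; lra.
  exact: cn.
Qed.

(** A bounded modulus is at most [eta] near its zero, hence everywhere by
    [annulus_le]. The Gaussian factor is harmless, as it is the exponential of a
    harmonic function. *)
Lemma liouville N (D l : R) : log_subharmonic N -> 0 < D ->
  (forall s t, N s t <= D * expR (2 * l * (s ^+ 2 - t ^+ 2))) ->
  N 0 0 = 0 -> forall s t, N s t = 0.
Proof.
move=> hN D0 N_le N00 s t; apply/le_anti/andP; split; last first.
  by have [Ns [Nss [Nt [Ntt [N0 _ _ _ _]]]]] := hN.
set X := expR (2 * l * (s ^+ 2 - t ^+ 2)).
suff H eta : 0 < eta -> N s t <= eta * X.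
  rewrite leNgt; apply/negP => N0; have X0 : 0 < X := expR_gt0 _.
  have := H (N s t / (2 * X)); rewrite divr_gt0 ?mulr_gt0 // => /(_ isT).
  have -> : N s t / (2 * X) * X = N s t / 2 by field; rewrite gt_eqF.
  by lra.
move=> eta0.
pose M (p : R * R) := N p.1 p.2 * expR (- (2 * l * (p.1 ^+ 2 - p.2 ^+ 2))).
have cM : {for (0, 0), continuous M}.
  have [Ns [Nss [Nt [Ntt [_ cN _ _ _]]]]] := hN.
  apply: continuousM2; first exact: cN.
  apply: (@continuous_comp2 R (@expR R)); last exact: continuous_expR.
  apply: (@continuousN R R^o); apply: continuousM2; first exact: continuous_cst2.
  apply: continuousB2; apply: (@continuous_comp2 R (fun x => x ^+ 2));
    try exact: exprn_continuous.
    exact: continuous_fst.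
  exact: continuous_snd.
have [d d0 hd] : exists2 d, 0 < d & forall a b, `|a| < d -> `|b| < d ->
    N a b <= eta * expR (2 * l * (a ^+ 2 - b ^+ 2)).
  have M00 : M (0, 0) < eta by rewrite /M /= N00 mul0r.
  have := cvgr_lt _ cM _ M00 => /(_ (nbhs_filter _))/nbhs_ballP[d /= d0 hd].
  exists d => // a b ad bd.
  have /hd : ball ((0, 0) : R * R) d (a, b).
    by split; rewrite /ball /= sub0r normrN.
  by rewrite /M /= => /ltW; rewrite expRN ler_pdivrMr ?expR_gt0.
pose E := (d / 2) ^+ 2.
have E0 : 0 < E by rewrite exprn_gt0 // divr_gt0.
have small a b : a ^+ 2 + b ^+ 2 <= E ->
    N a b <= eta * expR (2 * l * (a ^+ 2 - b ^+ 2)).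
  have ub x y : x ^+ 2 + y ^+ 2 <= E -> `|x| < d.
    rewrite /E -(real_normK (num_real x)); have := normr_ge0 x.
    by have := sqr_ge0 y; nra.
  move=> abE; apply: hd; first exact: ub abE.
  by apply: (ub b a); rewrite addrC.
have [stE|stE] := leP (s ^+ 2 + t ^+ 2) E; first exact: small.
apply: (@ler_expR_eps R _ _ (ln ((s ^+ 2 + t ^+ 2) / E))).
  by rewrite mulr_ge0 ?expR_ge0 // ltW.
by move=> m m0; apply: (annulus_le hN D0 eta0 E0 m0 N_le small); exact: ltW.
Qed.

End liouville.

(** * Hardy's uncertainty principle *)

Section hardy.
Context {R : realType}.
Implicit Types (u : R -> R[i]) (C a : R).

Lemma joint_continuity (f fs : R -> R -> R) :
  (forall s t, is_derive s (1 : R) (f ^~ t) (fs s t)) ->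
  (forall s0, exists M, forall s t, `|s - s0| < 1 -> `|fs s t| <= M) ->
  (forall s t, {for t, continuous (f s)}) ->
  continuous (fun p : R * R => f p.1 p.2).
Proof.
move=> df bf cf [s0 t0] /=.
have [M hM] := bf s0.
have M0 : 0 <= M by apply: le_trans (hM s0 0 _) => //; rewrite subrr normr0.
apply/cvgrPdist_lt => /= e e0.
have /cvgrPdist_lt/(_ (e / 2)) := cf s0 t0.
rewrite divr_gt0 // => /(_ isT)/nbhs_ballP[d /= d0 hd].
pose r := Num.min d (Num.min 1 (e / (2 * (M + 1)))).
have M1 : 0 < 2 * (M + 1) by rewrite mulr_gt0 // ltr_wpDl.
have r0 : 0 < r by rewrite !lt_min d0 ltr01 divr_gt0.
suff : nbhs ((s0, t0) : R * R) [set p | `|f s0 t0 - f p.1 p.2| < e] by [].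
apply/nbhs_ballP; exists r => // -[s t] [/=]; rewrite /ball /= !lt_min.
move=> /and3P[_ hs1 hs2] /and3P[ht _ _].
have h1 : `|f s0 t0 - f s0 t| < e / 2 by exact: hd.
have h2 : `|f s0 t - f s t| <= M * `|s0 - s|.
  have MV x y : x < y -> (forall z, x < z < y -> `|z - s0| < 1) ->
      `|f y t - f x t| <= M * `|y - x|.
    move=> xy hz; have [|c cI ->] := @MVT R (f ^~ t) (fs ^~ t) x y xy.
      apply: continuous_subspaceT => z; exact: is_derive_continuous (df z t).
    by move: cI; rewrite in_itv /= => cI; rewrite normrM ler_wpM2r // hM // hz.
  have [ss|ss|->] := ltgtP s0 s; last by rewrite !subrr normr0 mulr0.
    rewrite distrC [`|s0 - s|]distrC; apply: MV => // z /andP[z1 z2].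
    rewrite gtr0_norm ?subr_gt0 // (lt_trans _ hs1) // distrC.
    by rewrite gtr0_norm ?subr_gt0 // ltrD2r.
  apply: MV => // z /andP[z1 z2].
  rewrite distrC gtr0_norm ?subr_gt0 // (lt_trans _ hs1) //.
  by rewrite gtr0_norm ?subr_gt0 // ler_ltD // ltrN2.
have h3 : M * `|s0 - s| <= e / 2.
  move: hs2; rewrite ltr_pdivlMr // => hs2.
  by have := normr_ge0 (s0 - s); lra.
rewrite -(subrK (f s0 t) (f s0 t0)) -addrA (le_lt_trans (ler_normD _ _)) //.
by rewrite [e]splitr ltr_leD // (le_trans h2).
Qed.

Lemma laplace_derive_fst C a u (s t : R) : 0 < a -> gdominated C a u ->
  is_cderive (fun s => laplace u (s +i* t)) s
    (laplace (fun x => x%:C * u x) (s +i* t)).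
Proof.
move=> a0 ub; have := is_cderive_laplace (0 +i* t) 1 s a0 ub.
have E (x : R) : (0 +i* t : R[i]) + 1 * x%:C = x +i* t.
  by apply: complex_eqP; rewrite !ReImE /=; ring.
rewrite [1 * laplace _ _]mul1r E; congr is_cderive.
by apply/funext => x; rewrite E.
Qed.

Lemma laplace_derive_snd C a u (s t : R) : 0 < a -> gdominated C a u ->
  is_cderive (fun t => laplace u (s +i* t)) t
    ((0 +i* 1) * laplace (fun x => x%:C * u x) (s +i* t)).
Proof.
move=> a0 ub; have := is_cderive_laplace (s +i* 0) (0 +i* 1) t a0 ub.
have E (x : R) : (s +i* 0 : R[i]) + (0 +i* 1) * x%:C = s +i* x.
  by apply: complex_eqP; rewrite !ReImE /=; ring.
rewrite E; congr is_cderive.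
by apply/funext => x; rewrite E.
Qed.

(** If [L] is the transform of [u] and [L1] that of [x u], the Cauchy-Riemann
    equations give [4 |L L1|^2] for both sides of the inequality required by
    [log_subharmonic]. *)
Lemma log_subharmonic_laplace C a u : 0 < a -> gdominated C a u ->
  log_subharmonic (fun s t => normc (laplace u (s +i* t)) ^+ 2).
Proof.
move=> a0 ub; pose u1 x := x%:C * u x; pose u2 x := x%:C * u1 x.
have ub1 : gdominated _ _ u1 := gdominated_mulx a0 ub.
have a20 : 0 < a / 2 by rewrite divr_gt0.
pose X s t := complex.Re (laplace u (s +i* t)).
pose Y s t := complex.Im (laplace u (s +i* t)).
pose X1 s t := complex.Re (laplace u1 (s +i* t)).
pose Y1 s t := complex.Im (laplace u1 (s +i* t)).
pose X2 s t := complex.Re (laplace u2 (s +i* t)).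
pose Y2 s t := complex.Im (laplace u2 (s +i* t)).
have NE s t : normc (laplace u (s +i* t)) ^+ 2 = X s t ^+ 2 + Y s t ^+ 2.
  by rewrite sqr_normcE.
have [dXs dYs] : (forall s t, is_derive s (1 : R) (X ^~ t) (X1 s t)) /\
    (forall s t, is_derive s (1 : R) (Y ^~ t) (Y1 s t)).
  by split => s t; have [] := laplace_derive_fst s t a0 ub.
have [dX1s dY1s] : (forall s t, is_derive s (1 : R) (X1 ^~ t) (X2 s t)) /\
    (forall s t, is_derive s (1 : R) (Y1 ^~ t) (Y2 s t)).
  by split => s t; have [] := laplace_derive_fst s t a20 ub1.
have [dXt dYt] : (forall s t, is_derive t (1 : R) (X s) (- Y1 s t)) /\
    (forall s t, is_derive t (1 : R) (Y s) (X1 s t)).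
  split => s t; have [d1 d2] := laplace_derive_snd s t a0 ub.
    by apply: (is_derive_eq d1); rewrite ReM /= mul0r mul1r sub0r.
  by apply: (is_derive_eq d2); rewrite ImM /= mul0r mul1r add0r.
have [dX1t dY1t] : (forall s t, is_derive t (1 : R) (X1 s) (- Y2 s t)) /\
    (forall s t, is_derive t (1 : R) (Y1 s) (X2 s t)).
  split => s t; have [d1 d2] := laplace_derive_snd s t a20 ub1.
    by apply: (is_derive_eq d1); rewrite ReM /= mul0r mul1r sub0r.
  by apply: (is_derive_eq d2); rewrite ImM /= mul0r mul1r add0r.
have bnd s0 : exists M, forall s t, `|s - s0| < 1 ->
    normc (laplace u1 (s +i* t)) <= M.
  exists (2 * (C * (1 + 2 / a)) * gint (a / 2) *
    expR ((`|s0| + 1) ^+ 2 / (4 * (a / 2)))).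
  move=> s t ss0; apply: le_trans (normc_laplace_le _ a20 ub1) _.
  rewrite ler_wpM2l //.
    by rewrite mulr_ge0 ?(ltW (gint_gt0 a20)) // mulr_ge0 // (gdominated_ge0 ub1).
  rewrite ler_expR ler_wpM2r //=; first by rewrite invr_ge0 mulr_ge0 // ltW.
  rewrite -(real_normK (num_real s)) ler_sqr ?nnegrE ?addr_ge0 //.
  rewrite -(subrK s0 s) (le_trans (ler_normD _ _)) // addrC lerD2l.
  exact: ltW.
have cX : continuous (fun p : R * R => X p.1 p.2).
  apply: joint_continuity dXs _ _.
    move=> s0; have [M hM] := bnd s0; exists M => s t st.
    by rewrite (le_trans _ (hM s t st)) // ler_Re_normc.
  by move=> s t; exact: is_derive_continuous (dXt s t).
have cY : continuous (fun p : R * R => Y p.1 p.2).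
  apply: joint_continuity dYs _ _.
    move=> s0; have [M hM] := bnd s0; exists M => s t st.
    by rewrite (le_trans _ (hM s t st)) // ler_Im_normc.
  by move=> s t; exact: is_derive_continuous (dYt s t).
rewrite (_ : (fun s t => normc (laplace u (s +i* t)) ^+ 2) =
  (fun s t => X s t ^+ 2 + Y s t ^+ 2)); last by apply/funext => s; apply/funext.
have dsq (f g : R -> R) (x f' g' : R) : is_derive x (1 : R) f f' ->
    is_derive x (1 : R) g g' ->
    is_derive x (1 : R) (fun y => f y ^+ 2 + g y ^+ 2)
      (2 * (f x * f' + g x * g')).
  move=> df dg; apply: (is_derive_eq (is_deriveD (is_deriveX 2 df)
    (is_deriveX 2 dg))).
  by rewrite /= /GRing.scale /=; ring.
have dprod (f g h k : R -> R) (x f' g' h' k' : R) :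
    is_derive x (1 : R) f f' -> is_derive x (1 : R) g g' ->
    is_derive x (1 : R) h h' -> is_derive x (1 : R) k k' ->
    is_derive x (1 : R) (fun y => 2 * (f y * g y + h y * k y))
      (2 * (f' * g x + f x * g' + h' * k x + h x * k')).
  move=> df dg dh dk; apply: (is_derive_eq (is_deriveZ 2 (is_deriveD
    (is_deriveM df dg) (is_deriveM dh dk)))).
  by rewrite /= /GRing.scale /=; ring.
exists (fun s t => 2 * (X s t * X1 s t + Y s t * Y1 s t)),
  (fun s t => 2 * (X1 s t * X1 s t + X s t * X2 s t + Y1 s t * Y1 s t
     + Y s t * Y2 s t)),
  (fun s t => 2 * (X s t * - Y1 s t + Y s t * X1 s t)),
  (fun s t => 2 * (- Y1 s t * - Y1 s t + X s t * - X2 s t + X1 s t * X1 s t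
     + Y s t * - Y2 s t)); split.
- by move=> s t; rewrite addr_ge0 // sqr_ge0.
- move=> p; apply: continuousD2;
    apply: (@continuous_comp2 R (fun x => x ^+ 2)); try exact: exprn_continuous.
    exact: cX.
  exact: cY.
- move=> s t; split.
    exact: (dsq (X ^~ t) (Y ^~ t) s _ _ (dXs s t) (dYs s t)).
  exact: (dprod (X ^~ t) (X1 ^~ t) (Y ^~ t) (Y1 ^~ t) s _ _ _ _
    (dXs s t) (dX1s s t) (dYs s t) (dY1s s t)).
- move=> s t; split.
    exact: (dsq (X s) (Y s) t _ _ (dXt s t) (dYt s t)).
  exact: (dprod (X s) (fun t => - Y1 s t) (Y s) (X1 s) t _ _ _ _
    (dXt s t) (is_deriveN (dY1t s t)) (dYt s t) (dX1t s t)).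
- by move=> s t; cbv beta; rewrite le_eqVlt; apply/orP; left; apply/eqP; ring.
Qed.

(** The trivial bound on the transform [L] and the assumption on the imaginary
    axis make [L w * cexp (- w^2 / (4 a))] bounded, by the Phragmen-Lindelof
    principle, and Liouville's theorem applies. *)
Lemma laplace_vanish C a D u : 0 < a -> gdominated C a u ->
  (forall t, normc (laplace u (0 +i* t)) <= D * expR (- (t ^+ 2 / (4 * a)))) ->
  laplace u 0 = 0 -> forall w, laplace u w = 0.
Proof.
move=> a0 ub hD u0 w.
have hN := log_subharmonic_laplace a0 ub.
have l0 : 0 < (4 * a)^-1 by rewrite invr_gt0 mulr_gt0.
have C0 := gdominated_ge0 ub.
have A0 : 0 <= 2 * C * gint a.
  by rewrite mulr_ge0 ?(ltW (gint_gt0 a0)) // mulr_ge0.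
pose B := 1 + 2 * C * gint a + `|D|.
have B0 : 0 < B by rewrite /B -addrA ltr_pwDl // addr_ge0.
have hB : 2 * C * gint a <= B by rewrite /B -addrA addrCA lerDl addr_ge0.
have hB' : D <= B by rewrite (le_trans (ler_norm D)) // /B lerDr addr_ge0.
have sq x y z : 0 <= x -> x <= B * expR y -> z = 2 * y ->
    x ^+ 2 <= B ^+ 2 * expR z.
  move=> x0 xB ->; rewrite mulr_natl mulr2n expRD -expr2 -exprMn.
  by rewrite ler_sqr ?nnegrE // mulr_ge0 ?expR_ge0 // ltW.
have hB2 : 0 < B ^+ 2 by rewrite exprn_gt0.
have PL := phragmen_lindelof hN hB2 l0.
have N0 := liouville hN hB2 (PL _ _) _ (complex.Re w) (complex.Im w).
apply/eq0_normc/eqP; rewrite -sqrf_eq0; apply/eqP.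
case: w N0 => s t /= N0; apply: N0.
- move=> a' b.
  apply: (sq (normc (laplace u (a' +i* b))) (a' ^+ 2 / (4 * a)) _ (normc_ge0 _)).
    apply: le_trans (normc_laplace_le _ a0 ub) _.
    by rewrite ler_wpM2r ?expR_ge0.
  by ring.
- move=> b.
  apply: (sq (normc (laplace u (0 +i* b))) (- (b ^+ 2 / (4 * a))) _ (normc_ge0 _)).
    by apply: le_trans (hD b) _; rewrite ler_wpM2r ?expR_ge0.
  by ring.
- have u00 : laplace u (0 +i* 0) = 0 by exact: u0.
  by have -> : normc (laplace u (0 +i* 0)) ^+ 2 = 0 by rewrite u00 normc0 expr0n.
Qed.

End hardy.

Section hardy_theorem.
Context {R : realType}.
Implicit Types (u : R -> R[i]) (C a : R).

Lemma laplace_cgauss_real0 a : 0 < a ->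
  laplace (cgauss a%:C) 0 = (gint a)%:C :> R[i].
Proof.
move=> a0; rewrite /laplace (@eq_cintegral _ _ (fun x => (gauss a 0 x)%:C)).
  apply: complex_eqP => /=; first exact: Rintegral_gauss.
  by rewrite Rintegral_cst // mul0r.
move=> x; rewrite mul0r cexp0 mulr1 /cgauss /gauss subr0 -cexp_real.
by congr cexp; apply: complex_eqP; rewrite !ReImE /=; ring.
Qed.

Lemma normc_laplace_cgauss_imag a (t : R) : 0 < a ->
  normc (laplace (cgauss a%:C) (0 +i* t)) = gint a * expR (- (t ^+ 2 / (4 * a))).
Proof.
move=> a0; rewrite laplace_cgauss // laplace_cgauss_real0 // normcM normc_cexp.
rewrite normc_real gtr0_norm ?gint_gt0 //; congr (_ * expR _).
have -> : (0 +i* t : R[i]) ^+ 2 / (4 * a%:C) = (- (t ^+ 2 / (4 * a)))%:C.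
  have -> : (4 * a%:C : R[i]) = (4 * a)%:C by rewrite rmorphM rmorph_nat.
  rewrite -fmorphV -mulNr rmorphM /=; congr (_ * _).
  by apply: complex_eqP; rewrite expr2 !ReImE /=; ring.
by [].
Qed.

Lemma gdominated_cgauss_real a : 0 < a -> gdominated 1 a (cgauss a%:C).
Proof. by move=> a0; exact: (@gdominated_cgauss R a%:C). Qed.

Lemma gdominatedB C a u C' v k : gdominated C a u -> gdominated C' a v ->
  gdominated (C + normc k * C') a (fun x => u x - k * v x).
Proof.
move=> [mu_ ub] [mv vb]; split.
  under eq_fun do rewrite -mulNr.
  by apply: cmeasurableD => //; apply: cmeasurableM => //; exact: cmeasurable_cst.
move=> x; rewrite (le_trans (le_normcD _ _)) // normcN normcM mulrDl.
by rewrite lerD // -mulrA ler_wpM2l // normc_ge0.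
Qed.

(** Hardy's uncertainty principle in the critical case. The imaginary axis
    carries the Fourier transform; both bounds are satisfied by the Gaussian of
    rate [a], so the multiple of it that cancels the value of the transform at
    [0] can be subtracted. *)
Lemma hardy C a D u : 0 < a -> gdominated C a u ->
  (forall t, normc (laplace u (0 +i* t)) <= D * expR (- (t ^+ 2 / (4 * a)))) ->
  forall w, laplace (fun x => u x - laplace u 0 / (gint a)%:C * cgauss a%:C x) w = 0.
Proof.
move=> a0 ub hD; set k := _ / _.
have gb := gdominated_cgauss_real a0.
have g0 : gint a != 0 by rewrite gt_eqF ?gint_gt0.
apply: (@laplace_vanish R (C + normc k * 1) a (D + normc k * gint a) _ a0).
- exact: gdominatedB.
- move=> t; rewrite (laplaceB _ _ a0 ub a0 gb).
  apply: (le_trans (le_normcD _ _)); rewrite normcN normcM.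
  rewrite normc_laplace_cgauss_imag // [leRHS]mulrDl mulrA.
  by apply: lerD; first exact: hD.
- rewrite (laplaceB _ _ a0 ub a0 gb) laplace_cgauss_real0 // /k divfK ?subrr //.
  by apply/eqP => -[] /eqP; rewrite (negbTE g0).
Qed.

(** A nonzero multiple of the critical Gaussian would have too slow a transform. *)
Lemma hardy_supercritical C a b D u : 0 < a -> gdominated C a u ->
  (4 * a)^-1 < b ->
  (forall t, normc (laplace u (0 +i* t)) <= D * expR (- (b * t ^+ 2))) ->
  forall w, laplace u w = 0.
Proof.
move=> a0 ub ab hD.
have D0 : 0 <= D.
  have := hD 0; rewrite expr0n mulr0 oppr0 expR0 mulr1.
  exact/le_trans/normc_ge0.
have hD' t : normc (laplace u (0 +i* t)) <= D * expR (- (t ^+ 2 / (4 * a))).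
  apply: le_trans (hD t) _; rewrite ler_wpM2l // ler_expR lerN2 mulrC.
  by rewrite ler_wpM2r ?sqr_ge0 // ltW.
have h := hardy a0 ub hD'; move: h; set k := _ / _ => h.
have gb := gdominated_cgauss_real a0.
have uE w : laplace u w = k * laplace (cgauss a%:C) w.
  by have := h w; rewrite (laplaceB _ _ a0 ub a0 gb) => /subr0_eq.
suff k0 : k = 0 by move=> w; rewrite uE k0 mul0r.
apply/eqP; rewrite -[_ == _]negbK -normc_gt0; apply/negP => k0.
have G0 : 0 < normc k * gint a by rewrite mulr_gt0 // gint_gt0.
pose c := b - (4 * a)^-1; have c0 : 0 < c by rewrite subr_gt0.
have key t : normc k * gint a * expR (c * t ^+ 2) <= D.
  have := hD t; rewrite uE normcM normc_laplace_cgauss_imag // mulrA => h1.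
  rewrite -(ler_pM2r (expR_gt0 (- (b * t ^+ 2)))).
  rewrite -[_ * expR (c * _) * _]mulrA -expRD.
  have -> : c * t ^+ 2 + - (b * t ^+ 2) = - (t ^+ 2 / (4 * a)).
    by rewrite /c; field; rewrite gt_eqF.
  exact: h1.
(* The value of [t ^+ 2] at which [1 + c t ^+ 2 <= expR (c t ^+ 2)] already
   contradicts [key]. *)
pose s := D / (normc k * gint a * c).
have s0 : 0 <= s by rewrite divr_ge0 // ltW // mulr_gt0.
have := key (Num.sqrt s); rewrite sqr_sqrtr // leNgt => /negP; apply.
apply: (@lt_le_trans _ _ (normc k * gint a * (1 + c * s))).
  rewrite mulrDr mulr1 (_ : _ * (c * s) = D) ?ltrDr //.
  by rewrite /s; field; rewrite !gt_eqF // ?gint_gt0.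
by rewrite ler_wpM2l ?(ltW G0) // expR_ge1Dx.
Qed.

End hardy_theorem.

(** * Square-integrable functions and unitary operators *)

Section square_integrable.
Context {R : realType}.
Notation mu := (@lebesgue_measure R).
Implicit Types (f g : R -> R) (u v : R -> R[i]).

Lemma Lfun2P f : f \in Lfun mu 2%:E <->
  measurable_fun setT f /\ mu.-integrable setT (EFin \o (fun x => f x ^+ 2)).
Proof.
split => [lf|[mf if2]].
  split; last exact: Lfun2_integrable_sqr.
  by move: lf; rewrite inE => /andP[]; rewrite inE.
rewrite inE; apply/andP; split; rewrite inE //= /finite_norm unlock.
apply: poweR_lty; have /integrableP[_] := if2.
apply: le_lt_trans; apply: ge0_le_integral => //.
- move=> x _; exact: poweR_ge0.
- apply/measurable_EFinP.
  apply/(@measurableT_comp _ _ _ _ _ _ (fun x : R => x `^ 2)%R) => //.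
  exact/measurableT_comp.
- by apply: measurableT_comp => //; apply/measurable_EFinP; exact: measurable_funX.
by move=> x _ /=; rewrite lee_fin normrX powR_mulrn.
Qed.

Lemma cLfun2_measurable u : cLfun 2%:E u -> cmeasurable u.
Proof. by move=> [/Lfun2P[? _] /Lfun2P[? _]]. Qed.

Lemma gdominated_cLfun (C a : R) u : 0 < a -> gdominated C a u ->
  cLfun 1%:E u /\ cLfun 2%:E u.
Proof.
move=> a0 ub; have C0 := gdominated_ge0 ub; case: ub => -[u1 u2] ub.
have ig : mu.-integrable setT (EFin \o (fun x => C * gauss a 0 x)).
  by apply: integrableRZ; exact: integrable_gauss.
have ig2 : mu.-integrable setT (EFin \o (fun x => C ^+ 2 * gauss a 0 x)).
  by apply: integrableRZ; exact: integrable_gauss.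
have gE x : gauss a 0 x = expR (- a * x ^+ 2) by rewrite /gauss subr0.
have sq f : measurable_fun setT f -> (forall x, `|f x| <= normc (u x)) ->
    mu.-integrable setT (EFin \o f) /\ f \in Lfun mu 2%:E.
  move=> mf fu; split.
    by apply: le_integrableR ig => // x; rewrite gE (le_trans (fu x)).
  apply/Lfun2P; split => //; apply: le_integrableR ig2.
    exact: measurable_funX.
  move=> x; rewrite normrX gE.
  apply: (@le_trans _ _ ((C * expR (- a * x ^+ 2)) ^+ 2)).
    by rewrite ler_sqr ?nnegrE ?mulr_ge0 ?expR_ge0 // (le_trans (fu x)).
  rewrite exprMn ler_wpM2l ?sqr_ge0 // expr2 ler_piMr ?expR_ge0 //.
  by rewrite -expR0 ler_expR mulNr oppr_le0 mulr_ge0 ?sqr_ge0 // ltW.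
have [r1 r2] := sq _ u1 (fun x => ler_Re_normc (u x)).
have [i1 i2] := sq _ u2 (fun x => ler_Im_normc (u x)).
by split; split => //; apply/Lfun1_integrable.
Qed.

Lemma Lfun2_linear f g (a b : R) : f \in Lfun mu 2%:E -> g \in Lfun mu 2%:E ->
  (fun x => a * f x + b * g x) \in Lfun mu 2%:E.
Proof.
move=> /Lfun2P[mf if2] /Lfun2P[mg ig2]; apply/Lfun2P; split.
  by apply: measurable_funD; apply: measurable_funM.
apply: (@le_integrableR R _
  (fun x => 2 * a ^+ 2 * f x ^+ 2 + 2 * b ^+ 2 * g x ^+ 2)).
- by apply: measurable_funX; apply: measurable_funD; apply: measurable_funM.
- move=> x; rewrite ger0_norm ?sqr_ge0 //.
  by have := sqr_ge0 (a * f x - b * g x); lra.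
- have i1 := integrableRZ (2 * a ^+ 2) if2.
  have i2 := integrableRZ (2 * b ^+ 2) ig2.
  have := integrableD measurableT i1 i2.
  by congr (_.-integrable _ _); apply/funext.
Qed.

Lemma cLfun2_linear u v k : cLfun 2%:E u -> cLfun 2%:E v ->
  cLfun 2%:E (fun x => k * u x + v x).
Proof.
move=> [u1 u2] [v1 v2]; split.
  rewrite (_ : (fun x => _) = (fun x => 1 * (complex.Re k * complex.Re (u x) +
    - complex.Im k * complex.Im (u x)) + 1 * complex.Re (v x))).
    exact: Lfun2_linear (Lfun2_linear _ _ u1 u2) v1.
  by apply/funext => x; rewrite !ReImE; ring.
rewrite (_ : (fun x => _) = (fun x => 1 * (complex.Re k * complex.Im (u x) +
  complex.Im k * complex.Re (u x)) + 1 * complex.Im (v x))).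
  exact: Lfun2_linear (Lfun2_linear _ _ u2 u1) v2.
by apply/funext => x; rewrite !ReImE; ring.
Qed.

Lemma cLfun2_0 : cLfun 2%:E (fun=> 0 : R[i]).
Proof.
by split; apply/Lfun2P; split => //=; under eq_fun do rewrite expr0n;
  exact: integrable0.
Qed.

Lemma ae_eq0_Rintegral_sqr f : f \in Lfun mu 2%:E ->
  \int[mu]_x (f x ^+ 2) = 0 -> {ae mu, forall x, f x = 0}.
Proof.
move=> /Lfun2P[mf if2] f0.
have mf2 : measurable_fun setT (EFin \o (fun x => f x ^+ 2)).
  by apply/measurable_EFinP; exact: measurable_funX.
have := (@ae_eq_integral_abs _ _ _ mu setT measurableT _ mf2).1.
move=> H; apply: ae_imp (H _).
  by move=> x /= /(_ I) [] /eqP; rewrite sqrf_eq0 => /eqP.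
under eq_integral do rewrite /= ger0_norm ?sqr_ge0 //.
by rewrite -[LHS]fineK ?[fine _]f0 //; exact: integrable_fin_num.
Qed.

Lemma L2dot_eq0 u : cLfun 2%:E u -> L2dot u u = 0 ->
  {ae mu, forall x, u x = 0}.
Proof.
move=> [u1 u2] /(congr1 (@complex.Re R)) /=.
have [[m1 i1] [m2 i2]] := ((Lfun2P _).1 u1, (Lfun2P _).1 u2).
rewrite (@eq_Rintegral _ _ _ mu setT
  (fun x => complex.Re (u x) ^+ 2 + complex.Im (u x) ^+ 2)); last first.
  by move=> x _; rewrite ReM ReJ ImJ; ring.
rewrite RintegralD // => /eqP; rewrite paddr_eq0; last 2 first.
- by apply: Rintegral_ge0 => x _; exact: sqr_ge0.
- by apply: Rintegral_ge0 => x _; exact: sqr_ge0.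
move=> /andP[/eqP r0 /eqP i0].
by apply: ae_imp2 (ae_eq0_Rintegral_sqr u1 r0) (ae_eq0_Rintegral_sqr u2 i0)
  => x re im; exact: complex_eqP.
Qed.

Lemma L2dot_ae u v u' v' : cmeasurable u -> cmeasurable v ->
  cmeasurable u' -> cmeasurable v' ->
  {ae mu, forall x, u x = u' x} -> {ae mu, forall x, v x = v' x} ->
  L2dot u v = L2dot u' v'.
Proof.
move=> mu_ mv mu' mv' uu vv; apply: cintegral_ae.
- by apply: cmeasurableM => //; exact: cmeasurableJ.
- by apply: cmeasurableM => //; exact: cmeasurableJ.
- by apply: ae_imp2 uu vv => x -> ->.
Qed.

Lemma L2dot_ae0 u : cmeasurable u -> {ae mu, forall x, u x = 0} ->
  L2dot u u = 0.
Proof.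
move=> mu_ u0; rewrite (L2dot_ae (u' := fun=> 0) (v' := fun=> 0)) //;
  try exact: cmeasurable_cst.
by apply: complex_eqP => /=; rewrite Rintegral_cst // !mul0r ?subrr ?addr0 mul0r.
Qed.

Section unitary.
Variable T : (R -> R[i]) -> R -> R[i].
Hypothesis uT : unitaryL2 T.

(** Operators act on representatives; this and the next lemma recover their
    compatibility with almost everywhere equality. *)
Lemma unitary_null u : cLfun 2%:E u ->
  {ae mu, forall x, u x = 0} <-> {ae mu, forall x, T u x = 0}.
Proof.
move=> lu; have lTu := unitaryL2_stable uT lu.
split => u0; apply: L2dot_eq0 => //.
  by rewrite unitaryL2_dot // L2dot_ae0 //; exact: cLfun2_measurable.
by rewrite -(unitaryL2_dot uT) // L2dot_ae0 //; exact: cLfun2_measurable.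
Qed.

Lemma unitary_ae u v : cLfun 2%:E u -> cLfun 2%:E v ->
  {ae mu, forall x, u x = v x} -> {ae mu, forall x, T u x = T v x}.
Proof.
move=> lu lv uv.
have ld := cLfun2_linear (-1) lu lv.
have d0 : {ae mu, forall x, -1 * u x + v x = 0}.
  by apply: ae_imp uv => x ->; rewrite mulN1r addNr.
have Td0 := (unitary_null ld).1 d0.
apply: ae_imp2 Td0 (unitaryL2_linear uT (-1) lu lv) => x -> /esym.
by rewrite mulN1r => /eqP; rewrite addrC subr_eq0 => /eqP ->.
Qed.

Lemma unitaryZ k u : cLfun 2%:E u ->
  {ae mu, forall x, T (fun y => k * u y) x = k * T u x}.
Proof.
move=> lu; have l0 := cLfun2_0.
have z0 := (unitary_null l0).1 (aeW mu (fun x => erefl)).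
have := unitaryL2_linear uT k lu l0.
rewrite (_ : (fun y => k * u y + 0) = (fun y => k * u y)); last first.
  by apply/funext => y; rewrite addr0.
by move=> h; apply: ae_imp2 z0 h => x ->; rewrite addr0.
Qed.

End unitary.

End square_integrable.

(** * Metaplectic operators on chirps *)

Section chirps.
Context {R : realType}.
Notation mu := (@lebesgue_measure R).
Notation I := (0 +i* 1 : R[i]).
Notation "`pi" := ((pi : R)%:C) : ring_scope.
Implicit Types (S : 'M[R]_2) (T : (R -> R[i]) -> (R -> R[i])) (q p r : R[i]).

(** A Gaussian annihilated by [q D - p x - r], with [D = (2 i pi)^-1 d/dx]: it
    is attached to the complex line through [(q, p)] of phase space, on which
    metaplectic operators act through their matrices. *)
Definition chirp q p r (x : R) : R[i] :=
  cexp (I * `pi * (p / q * (x ^+ 2)%:C + 2 * (r / q) * x%:C)).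

(** The sign of [Im (p / q)], in a form that is manifestly invariant under real
    matrices of determinant one; positive lines have decaying chirps. *)
Definition positive_line q p : Prop := 0 < complex.Im (p * q^*).

Lemma positive_line_neq0 q p : positive_line q p -> q != 0.
Proof.
by rewrite /positive_line; apply: contraTneq => ->; rewrite !ReImE /= oppr0 !mulr0
  addr0 ltxx.
Qed.

Lemma positive_line_slope q p : positive_line q p -> 0 < complex.Im (p / q).
Proof.
move=> qp; have q0 := positive_line_neq0 qp.
have n0 : 0 < normc q ^+ 2 by rewrite exprn_gt0 // normc_gt0.
have -> : p / q = p * q^* * ((normc q ^+ 2)^-1)%:C.
  have -> : ((normc q ^+ 2)^-1)%:C = (q * q^*)^-1.
    rewrite fmorphV; congr (_^-1); rewrite sqr_normcE.
    by apply: complex_eqP; rewrite !ReImE /=; ring.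
  have qJ0 : q^* != 0 by rewrite conjc_eq0.
  by rewrite invfM mulrACA mulfV ?mulr1.
by rewrite ImM /= mulr0 add0r mulr_gt0 // invr_gt0.
Qed.

Lemma chirp_gaussE q p r x : chirp q p r x =
  cgauss (- (I * `pi * (p / q))) x * cexp (2 * I * `pi * (r / q) * x%:C).
Proof. by rewrite /chirp /cgauss -cexpD; congr cexp; ring. Qed.

Lemma Re_chirp_rate q p :
  complex.Re (- (I * `pi * (p / q))) = pi * complex.Im (p / q).
Proof. by case: (p / q) => a b; rewrite !ReImE /=; ring. Qed.

Lemma normc_chirp q p r x : normc (chirp q p r x) =
  expR (- (pi * complex.Im (p / q)) * x ^+ 2 +
        - (2 * pi * complex.Im (r / q)) * x).
Proof.
rewrite chirp_gaussE normcM !normc_cexp -expRD; congr expR.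
rewrite -Re_chirp_rate; case: (p / q) => a b; case: (r / q) => c d.
by rewrite !ReImE /=; ring.
Qed.

Lemma cmeasurable_chirp q p r : cmeasurable (chirp q p r).
Proof.
rewrite (funext (chirp_gaussE q p r)); apply: cmeasurable_laplace.
exact: cmeasurable_cgauss.
Qed.

Lemma gdominated_exp (u : R -> R[i]) (a b : R) : 0 < a -> cmeasurable u ->
  (forall x, normc (u x) <= expR (- a * x ^+ 2 + b * x)) ->
  gdominated (expR (b ^+ 2 / (2 * a))) (a / 2) u.
Proof.
move=> a0 mu_ ub; split => // x; rewrite -expRD (le_trans (ub x)) // ler_expR.
rewrite -subr_ge0.
have -> : b ^+ 2 / (2 * a) + - (a / 2) * x ^+ 2 - (- a * x ^+ 2 + b * x) =
  (a * x - b) ^+ 2 / (2 * a) by field; rewrite gt_eqF.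
by rewrite divr_ge0 ?sqr_ge0 // mulr_ge0 // ltW.
Qed.

Lemma chirp_rate_gt0 q p : positive_line q p -> 0 < pi * complex.Im (p / q).
Proof. by move=> qp; rewrite mulr_gt0 ?pi_gt0 ?positive_line_slope. Qed.

Lemma cLfun_chirp q p r : positive_line q p ->
  cLfun 1%:E (chirp q p r) /\ cLfun 2%:E (chirp q p r).
Proof.
move=> qp; have a0 := chirp_rate_gt0 qp.
have a20 : 0 < pi * complex.Im (p / q) / 2 by rewrite divr_gt0.
apply: (gdominated_cLfun a20); apply: gdominated_exp => //.
  exact: cmeasurable_chirp.
by move=> x; rewrite normc_chirp.
Qed.

Lemma L2dot_chirp q p r : positive_line q p ->
  L2dot (chirp q p r) (chirp q p r) =
  (expR ((4 * pi * complex.Im (r / q)) ^+ 2 / (8 * (pi * complex.Im (p / q))))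
   * gint (2 * (pi * complex.Im (p / q))))%:C.
Proof.
move=> qp; have a0 := chirp_rate_gt0 qp.
have a20 : 0 < 2 * (pi * complex.Im (p / q)) by rewrite mulr_gt0.
set u := chirp q p r.
have re : \int[mu]_x complex.Re (u x * (u x)^*) =
    expR ((4 * pi * complex.Im (r / q)) ^+ 2 / (8 * (pi * complex.Im (p / q))))
    * gint (2 * (pi * complex.Im (p / q))).
  rewrite (@eq_Rintegral _ _ _ mu setT (fun x =>
    expR (- (2 * (pi * complex.Im (p / q))) * x ^+ 2 +
     - (4 * pi * complex.Im (r / q)) * x))).
    rewrite Rintegral_gauss_exp //; congr (expR _ * _); rewrite sqrrN.
    by congr (_ / _); ring.
  move=> x _; rewrite ReM ReJ ImJ mulrN opprK -!expr2 -sqr_normcE normc_chirp.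
  by rewrite expr2 -expRD; congr expR; ring.
have im : \int[mu]_x complex.Im (u x * (u x)^*) = 0.
  rewrite (@eq_Rintegral _ _ _ mu setT (fun=> 0)) ?Rintegral_cst ?mul0r //.
  by move=> x _; rewrite ImM ReJ ImJ; ring.
by rewrite /L2dot /cintegral re im.
Qed.

Lemma L2dot_chirp_neq0 q p r : positive_line q p ->
  L2dot (chirp q p r) (chirp q p r) != 0.
Proof.
move=> qp; rewrite L2dot_chirp //; apply/eqP => -[] /eqP.
by rewrite gt_eqF // mulr_gt0 ?expR_gt0 // gint_gt0 // mulr_gt0 // chirp_rate_gt0.
Qed.

Lemma det2 S : \det S = S 0 0 * S 1 1 - S 0 1 * S 1 0.
Proof.
rewrite (expand_det_row _ 0) big_ord_recl big_ord1 /cofactor !det_mx11 !mxE /=.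
have -> : lift ord0 ord0 = 1 :> 'I_2 by apply/val_inj.
have -> : lift 1 0 = 0 :> 'I_2 by apply/val_inj.
by rewrite /bump /= !expr0 expr1; ring.
Qed.

(** The coordinates of the image of [(q, p)] are kept apart, rather than in a
    column vector, because a chirp depends on their quotient. *)
Definition act1 S q p : R[i] := (S 0 0)%:C * q + (S 0 1)%:C * p.
Definition act2 S q p : R[i] := (S 1 0)%:C * q + (S 1 1)%:C * p.

Lemma positive_line_act S q p : Sp2 S -> positive_line q p ->
  positive_line (act1 S q p) (act2 S q p).
Proof.
rewrite /Sp2 det2 /positive_line /act1 /act2 => dS.
case: q => q1 q2; case: p => p1 p2; rewrite !ReImE /= => h.
rewrite (_ : _ + _ = (S 0 0 * S 1 1 - S 0 1 * S 1 0) * (p1 * - q2 + p2 * q1)).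
  by rewrite dS mul1r.
by ring.
Qed.

Lemma metaplectic_kernelE S (xi x : R) : metaplectic_kernel S xi x =
  cexp (I * `pi * ((S 1 1 / S 0 1)%:C * (xi ^+ 2)%:C)) *
  (cexp (I * `pi * (S 0 0 / S 0 1)%:C * (x ^+ 2)%:C) *
   cexp ((0 +i* (- 2 * pi * (xi / S 0 1))) * x%:C)).
Proof.
rewrite /metaplectic_kernel -!cexpD; congr cexp.
by apply: complex_eqP; rewrite !ReImE /=; ring.
Qed.

(** The integral kernel is the exponential of a quadratic form, so the image of a
    chirp is a Gaussian integral, again a chirp by [laplace_cgauss]. The
    parameter [r] is unchanged, which is what makes the rule multiplicative. *)
Lemma free_metaplectic_chirp S T q p r :
  free_metaplectic S T -> positive_line q p ->
  exists c, {ae mu, forall x, T (chirp q p r) x =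
     c * chirp (act1 S q p) (act2 S q p) r x}.
Proof.
move=> [dS b0 uT [kappa [_ Tker]]] qp.
have [l1 l2] := cLfun_chirp r qp.
have q0 := positive_line_neq0 qp.
have q'0 := positive_line_neq0 (positive_line_act dS qp).
have bC0 : (S 0 1)%:C != 0 :> R[i].
  by apply/eqP => -[] /eqP; rewrite (negbTE b0).
pose z := - (I * `pi * (p / q + (S 0 0 / S 0 1)%:C)).
have zE : z = - (I * `pi) * (act1 S q p / (q * (S 0 1)%:C)).
  by rewrite /z /act1 rmorphM fmorphV; field; rewrite q0 bC0.
have z0 : 0 < complex.Re z.
  suff -> : complex.Re z = pi * complex.Im (p / q) by exact: chirp_rate_gt0.
  by rewrite /z; case: (p / q) => ? ?; rewrite !ReImE /=; ring.
pose c := kappa / (Num.sqrt `|S 0 1|)%:C * laplace (cgauss z) 0 *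
  cexp (- (I * `pi * (r ^+ 2 * (S 0 1)%:C / (q * act1 S q p)))).
exists c; apply: ae_imp (Tker _ l1 l2) => xi ->.
pose w := 2 * I * `pi * (r / q - (xi / S 0 1)%:C).
pose e := cexp (I * `pi * ((S 1 1 / S 0 1)%:C * (xi ^+ 2)%:C)).
rewrite (@eq_cintegral _ _ (fun x => e * (cgauss z x * cexp (w * x%:C)))); last first.
  move=> x; rewrite chirp_gaussE metaplectic_kernelE /cgauss /e -!cexpD.
  congr cexp; rewrite /z /w.
  have -> : (0 +i* (- 2 * pi * (xi / S 0 1)) : R[i]) =
    - 2 * I * `pi * (xi / S 0 1)%:C.
    by apply: complex_eqP; rewrite !ReImE /=; ring.
  by ring.
rewrite cintegralZ; last first.
  exact: (cintegrable_laplace w z0 (gdominated_cgauss z)).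
rewrite -/(laplace _ _) (laplace_cgauss z0) /c /chirp.
have -> : e * (laplace (cgauss z) 0 * cexp (w ^+ 2 / (4 * z))) =
  laplace (cgauss z) 0 * cexp (I * `pi * ((S 1 1 / S 0 1)%:C * (xi ^+ 2)%:C)
    + w ^+ 2 / (4 * z)) by rewrite cexpD /e; ring.
set E1 := I * `pi * _ + _; set E2 := - (_ * _); set E3 := I * `pi * (_ + _).
suff -> : E1 = E2 + E3 by rewrite cexpD; ring.
rewrite /E1 /E2 /E3.
rewrite zE /w !rmorphM !fmorphV /=.
have piC0 : `pi != 0 :> R[i].
  by apply/eqP => -[] /eqP; rewrite gt_eqF ?pi_gt0.
have I0 : I != 0 by apply/eqP => -[] /eqP; rewrite oner_eq0.
have dC : (S 1 0)%:C = ((S 0 0)%:C * (S 1 1)%:C - 1) / (S 0 1)%:C :> R[i].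
  have e1 : (S 0 0)%:C * (S 1 1)%:C - (S 0 1)%:C * (S 1 0)%:C = 1 :> R[i].
    by rewrite -!rmorphM -rmorphB -det2 dS.
  by rewrite -e1; field.
move: q'0 bC0 piC0 I0; rewrite /act1 /act2 dC.
move: (S 0 0)%:C (S 0 1)%:C (S 1 1)%:C `pi I xi%:C => a b d P J y q'0 b0' P0 J0.
by field; rewrite q'0 b0' q0 P0 J0.
Qed.

Lemma act_mul S1 S2 q p :
  act1 (S1 *m S2) q p = act1 S1 (act1 S2 q p) (act2 S2 q p) /\
  act2 (S1 *m S2) q p = act2 S1 (act1 S2 q p) (act2 S2 q p).
Proof.
have E i j : (S1 *m S2) i j = S1 i 0 * S2 0 j + S1 i 1 * S2 1 j.
  have l01 : lift ord0 ord0 = 1 :> 'I_2 by apply/val_inj.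
  by rewrite mxE big_ord_recl big_ord1 l01.
by rewrite /act1 /act2 !E !rmorphD !rmorphM /=; split; ring.
Qed.

Lemma metaplectic_unitary S T : metaplectic S T -> unitaryL2 T.
Proof. by move=> [[]|[]]. Qed.

(** For a product of two free operators, the action of a product of matrices is
    the composition of their actions. *)
Lemma metaplectic_chirp S T q p r :
  metaplectic S T -> positive_line q p ->
  exists c, {ae mu, forall x, T (chirp q p r) x =
     c * chirp (act1 S q p) (act2 S q p) r x}.
Proof.
move=> [|[uT [S1 [S2 [T1 [T2 [s [f1 f2 -> TE]]]]]]]] qp.
  by move=> fS; exact: free_metaplectic_chirp.
have [d1 _ u1 _] := f1; have [d2 _ u2 _] := f2.
have qp2 := positive_line_act d2 qp.
have [c2 h2] := free_metaplectic_chirp r f2 qp.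
have [c1 h1] := free_metaplectic_chirp r f1 qp2.
have [_ l] := cLfun_chirp r qp; have [_ l2] := cLfun_chirp r qp2.
have lZ : cLfun 2%:E (fun x => c2 * chirp (act1 S2 q p) (act2 S2 q p) r x).
  have := cLfun2_linear c2 l2 cLfun2_0.
  by congr (cLfun _ _); apply/funext => x; rewrite addr0.
exists ((-1) ^+ s * c2 * c1).
have [-> ->] := act_mul S1 S2 q p.
have e1 := unitary_ae u1 (unitaryL2_stable u2 l) lZ h2.
have e2 := unitaryZ u1 c2 l2.
have e12 : {ae mu, forall x, T1 (T2 (chirp q p r)) x =
    c2 * T1 (chirp (act1 S2 q p) (act2 S2 q p) r) x}.
  by apply: ae_imp2 e1 e2 => x -> ->.
have e : {ae mu, forall x, T1 (T2 (chirp q p r)) x = c2 * (c1 *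
    chirp (act1 S1 (act1 S2 q p) (act2 S2 q p))
      (act2 S1 (act1 S2 q p) (act2 S2 q p)) r x)}.
  by apply: ae_imp2 e12 h1 => x -> ->.
by apply: ae_imp2 (TE _ l) e => x -> ->; rewrite !mulrA.
Qed.

End chirps.

(** * Transfer of decay between two metaplectic images *)

Section transfer.
Context {R : realType}.
Notation mu := (@lebesgue_measure R).
Notation I := (0 +i* 1 : R[i]).
Notation "`pi" := ((pi : R)%:C) : ring_scope.
Implicit Types (S : 'M[R]_2) (T : (R -> R[i]) -> (R -> R[i])) (u v : R -> R[i]).

Lemma metaplectic_free S T : metaplectic S T ->
  exists S' T', free_metaplectic S' T'.
Proof.
move=> [fT|[_ [S1 [S2 [T1 [T2 [s [f1 _ _ _]]]]]]]]; first by exists S, T.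
by exists S1, T1.
Qed.

Lemma gdominatedM C a u v : gdominated C a u -> cmeasurable v ->
  (forall x, normc (v x) = 1) -> gdominated C a (fun x => u x * v x).
Proof.
move=> [mu_ ub] mv v1; split; first exact: cmeasurableM.
by move=> x; rewrite normcM v1 mulr1.
Qed.

Lemma normc_cexp_imag (x : R) : normc (cexp (0 +i* x)) = 1.
Proof. by rewrite normc_cexp /= expR0. Qed.

(** Up to chirps and a dilation a free metaplectic operator is the Fourier
    transform, so its unitarity contains Plancherel's theorem. *)
Lemma fourier_injective S T C a u : free_metaplectic S T -> 0 < a ->
  gdominated C a u -> (forall t, laplace u (0 +i* t) = 0) ->
  {ae mu, forall x, u x = 0}.
Proof.
move=> [dS b0 uT [kappa [_ Tker]]] a0 ub u0.
pose e x := cexp (0 +i* (- (pi * (S 0 0 / S 0 1) * x ^+ 2))).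
have me : cmeasurable e.
  apply: cmeasurable_cexp; split; first exact: measurable_cst.
  apply: measurable_funN; apply: measurable_funM; first exact: measurable_cst.
  exact: measurable_funX.
have vb : gdominated C a (fun x => u x * e x).
  by apply: gdominatedM => // x; exact: normc_cexp_imag.
have [l1 l2] := gdominated_cLfun a0 vb.
have Tv0 : {ae mu, forall x, T (fun x => u x * e x) x = 0}.
  apply: ae_imp (Tker _ l1 l2) => xi ->.
  rewrite (@eq_cintegral _ _ (fun x =>
    cexp (I * `pi * ((S 1 1 / S 0 1)%:C * (xi ^+ 2)%:C)) *
    (u x * cexp ((0 +i* (- 2 * pi * (xi / S 0 1))) * x%:C)))); last first.
    move=> x; rewrite metaplectic_kernelE.
    have -> : cexp (I * `pi * (S 0 0 / S 0 1)%:C * (x ^+ 2)%:C) = (e x)^-1.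
      apply: (mulfI (cexp_neq0 (0 +i* (- (pi * (S 0 0 / S 0 1) * x ^+ 2))))).
      rewrite divff ?cexp_neq0 // -cexpD -[RHS]cexp0; congr cexp.
      by apply: complex_eqP; rewrite !ReImE /=; ring.
    by field; exact: cexp_neq0.
  rewrite cintegralZ; last exact: cintegrable_laplace ub.
  by rewrite [cintegral _]u0 !mulr0.
have v0 := (unitary_null uT l2).2 Tv0.
apply: ae_imp v0 => x /eqP; rewrite mulf_eq0 => /orP[/eqP //|].
by rewrite (negbTE (cexp_neq0 _)).
Qed.

Lemma cintegrable_L2dot u v : cLfun 2%:E u -> cLfun 2%:E v ->
  cintegrable (fun x => u x * (v x)^*).
Proof.
move=> [u1 u2] [v1 v2].
have m (f g : R -> R) : f \in Lfun mu 2%:E -> g \in Lfun mu 2%:E ->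
    mu.-integrable setT (EFin \o (fun x => f x * g x)).
  by move=> lf lg; exact: (Lfun1_integrable _ _).1 (Lfun2_mul_Lfun1 lf lg).
split.
  have := integrableD measurableT (m _ _ u1 v1) (m _ _ u2 v2).
  by congr (_.-integrable _ _); apply/funext => x; rewrite /= ReM ReJ ImJ -EFinD;
    congr EFin; ring.
have := integrableB measurableT (m _ _ u2 v1) (m _ _ u1 v2).
by congr (_.-integrable _ _); apply/funext => x; rewrite /= ImM ReJ ImJ -EFinB;
  congr EFin; ring.
Qed.

Lemma L2dotZr u v k : cLfun 2%:E u -> cLfun 2%:E v ->
  L2dot u (fun x => k * v x) = k^* * L2dot u v.
Proof.
move=> lu lv; rewrite -cintegralZ; last exact: cintegrable_L2dot.
by apply: eq_cintegral => x; rewrite rmorphM /=; ring.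
Qed.

Lemma L2dotZ u k : cLfun 2%:E u ->
  L2dot (fun x => k * u x) (fun x => k * u x) = k * k^* * L2dot u u.
Proof.
move=> lu; rewrite -cintegralZ; last exact: cintegrable_L2dot.
by apply: eq_cintegral => x; rewrite rmorphM /=; ring.
Qed.

(** Unitarity transports the pairing with a chirp from one side to the other;
    the unknown constants are eliminated by comparing the norms of the chirps. *)
Lemma chirp_transfer S1 S2 T1 T2 q p r f :
  metaplectic S1 T1 -> metaplectic S2 T2 -> Sp2 S1 -> Sp2 S2 ->
  positive_line q p -> cLfun 2%:E f ->
  let ch1 := chirp (act1 S1 q p) (act2 S1 q p) r in
  let ch2 := chirp (act1 S2 q p) (act2 S2 q p) r in
  normc (L2dot (T1 f) ch1) ^+ 2 * normc (L2dot ch2 ch2) =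
  normc (L2dot (T2 f) ch2) ^+ 2 * normc (L2dot ch1 ch1).
Proof.
move=> m1 m2 d1 d2 qp lf ch1 ch2.
have u1 := metaplectic_unitary m1; have u2 := metaplectic_unitary m2.
have [_ lG] := cLfun_chirp r qp.
have [_ l1] := cLfun_chirp r (positive_line_act d1 qp).
have [_ l2] := cLfun_chirp r (positive_line_act d2 qp).
have step S T : metaplectic S T -> Sp2 S ->
    let ch := chirp (act1 S q p) (act2 S q p) r in exists k,
    L2dot f (chirp q p r) = k^* * L2dot (T f) ch /\
    L2dot (chirp q p r) (chirp q p r) = k * k^* * L2dot ch ch.
  move=> mT dS ch; have uT := metaplectic_unitary mT.
  have [_ l] := cLfun_chirp r (positive_line_act dS qp).
  have [k hk] := metaplectic_chirp r mT qp; exists k.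
  have lTf := unitaryL2_stable uT lf; have lTG := unitaryL2_stable uT lG.
  have mk : cmeasurable (fun x => k * ch x).
    apply: cmeasurableM; first exact: cmeasurable_cst.
    exact: cmeasurable_chirp.
  have rfl u : {ae mu, forall x, u x = u x :> R[i]} by exact: aeW.
  split.
    rewrite -(unitaryL2_dot uT) // -L2dotZr //; apply: L2dot_ae => //.
    + exact: cLfun2_measurable.
    + exact: cLfun2_measurable.
    + exact: cLfun2_measurable.
  rewrite -(unitaryL2_dot uT) // -L2dotZ //; apply: L2dot_ae => //.
  + exact: cLfun2_measurable.
  + exact: cLfun2_measurable.
have [k1 [p1 n1]] := step _ _ m1 d1; have [k2 [p2 n2]] := step _ _ m2 d2.
have k10 : normc k1 ^+ 2 != 0.
  rewrite sqrf_eq0 gt_eqF // normc_gt0; apply/eqP => k10.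
  by have := L2dot_chirp_neq0 r qp; rewrite n1 k10 !mul0r eqxx.
have := congr1 (fun z => normc z ^+ 2) (etrans (esym p1) p2).
have := congr1 (fun z => normc z) (etrans (esym n1) n2).
rewrite !normcM !normcJ -!expr2 !exprMn -/ch1 -/ch2 => h1 h2.
apply: (mulfI k10); rewrite mulrA h2 -mulrA mulrCA [in RHS]mulrA.
by rewrite [normc k1 ^+ 2 * _]mulrC -[in RHS]mulrA h1; ring.
Qed.

(** Laplace transforms require a bound at every point; modifying [u] on a null
    set provides it. *)
Lemma truncation u C a : cmeasurable u ->
  {ae mu, forall x, `|u x| <= (C * expR (- a * x ^+ 2))%:C} -> 0 <= C ->
  exists v, gdominated C a v /\ {ae mu, forall x, u x = v x}.
Proof.
move=> [u1 u2] ub C0.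
pose b x := normc (u x) <= C * expR (- a * x ^+ 2).
have mb : measurable_fun setT b.
  apply: measurable_fun_ler.
    rewrite (_ : (fun x => _) = (fun x => Num.sqrt (complex.Re (u x) ^+ 2 +
      complex.Im (u x) ^+ 2))); last first.
      by apply/funext => x; case: (u x).
    apply: (measurableT_comp (f := @Num.sqrt R)).
      by apply: continuous_measurable_fun; exact: sqrt_continuous.
    by apply: measurable_funD; exact: measurable_funX.
  apply: measurable_funM => //; apply: measurableT_comp => //.
  by apply: measurable_funM => //; exact: measurable_funX.
exists (fun x => if b x then u x else 0); split; last first.
  by apply: ae_imp ub => x; rewrite ler_normc_real -/(b x) => ->.
split; last first.
  move=> x; case: ifPn => // _; rewrite normc0.
  by rewrite mulr_ge0 // expR_ge0.
split.
  rewrite (_ : (fun x => _) = (fun x => if b x then complex.Re (u x) else 0)).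
    exact: measurable_fun_ifT.
  by apply/funext => x; case: ifP.
rewrite (_ : (fun x => _) = (fun x => if b x then complex.Im (u x) else 0)).
  exact: measurable_fun_ifT.
by apply/funext => x; case: ifP.
Qed.

End transfer.

Section main.
Context {R : realType}.
Notation mu := (@lebesgue_measure R).
Notation I := (0 +i* 1 : R[i]).
Notation "`pi" := ((pi : R)%:C) : ring_scope.
Implicit Types (S : 'M[R]_2) (T : (R -> R[i]) -> (R -> R[i])) (u v : R -> R[i]).

Let pi0 : 0 < (pi : R). Proof. exact: pi_gt0. Qed.

(** A chirp of real slope [- (a / b)] would be mapped to a Dirac mass; adding [i]
    regularises it while keeping every Gaussian integral convergent. *)
Definition slope (a b : R) : R[i] := (- (a / b)) +i* 1.

Lemma chirp_slopeE (a b s x : R) : (chirp 1 (slope a b) s%:C x)^* =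
  cexp (- (pi +i* (- (pi * (a / b)))) * (x ^+ 2)%:C) *
  cexp ((0 +i* (- (2 * pi * s))) * x%:C).
Proof.
rewrite /chirp cexpJ -cexpD !divr1; congr cexp.
by apply: complex_eqP; rewrite !ReImE /slope /=; ring.
Qed.

(** The line is chosen so that its image under [S1] is [(1, slope a b)]: pairing
    [T1 f] with these chirps, of frequency [s], gives the Laplace transform of
    the statement at [- 2 i pi s]. The image under [S2] is then the line of
    [(i b, p2)] with [Im (p2 / (i b)) = b ^- 2], whose chirps have the modulus of
    a Gaussian centred at [b s]; their pairing with [T2 f] decays in [s] because
    [T2 f] does. *)
Lemma transfer_bound S1 S2 T1 T2 (f g h : R -> R[i]) (C1 C2 alpha beta : R) :
  let a := S2 0 0 * S1 1 1 - S2 0 1 * S1 1 0 in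
  let b := S1 0 0 * S2 0 1 - S2 0 0 * S1 0 1 in
  Sp2 S1 -> Sp2 S2 -> b != 0 -> metaplectic S1 T1 -> metaplectic S2 T2 ->
  cLfun 2%:E f -> 0 < alpha -> 0 < beta ->
  gdominated C1 alpha g -> {ae mu, forall x, T1 f x = g x} ->
  gdominated C2 beta h -> {ae mu, forall x, T2 f x = h x} ->
  exists K, forall t, normc (laplace (fun x => g x *
      cexp (- (pi +i* (- (pi * (a / b)))) * (x ^+ 2)%:C)) (0 +i* t)) <=
    K * expR (- (beta * b ^+ 2 / (4 * pi * (beta * b ^+ 2 + pi)) * t ^+ 2)).
Proof.
move=> a b dS1 dS2 b0 m1 m2 lf alpha0 beta0 gb Tg hb Th.
have [lTf1 lTf2] := (unitaryL2_stable (metaplectic_unitary m1) lf,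
  unitaryL2_stable (metaplectic_unitary m2) lf).
have C20 := gdominated_ge0 hb.
have b2 : 0 < b ^+ 2 by rewrite exprn_even_gt0.
pose q := (S1 1 1)%:C - (S1 0 1)%:C * slope a b.
pose p := - (S1 1 0)%:C + (S1 0 0)%:C * slope a b.
move: (dS1) (dS2); rewrite /Sp2 !det2 => D1 D2.
have q1E : act1 S1 q p = 1.
  have -> : act1 S1 q p = (S1 0 0 * S1 1 1 - S1 0 1 * S1 1 0)%:C.
    by rewrite /act1 /q /p; apply: complex_eqP; rewrite !ReImE /=; ring.
  by rewrite D1.
have p1E : act2 S1 q p = slope a b.
  have -> : act2 S1 q p = (S1 0 0 * S1 1 1 - S1 0 1 * S1 1 0)%:C * slope a b.
    by rewrite /act2 /q /p; apply: complex_eqP; rewrite !ReImE /=; ring.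
  by rewrite D1 mul1r.
have q2E : act1 S2 q p = 0 +i* b.
  have -> : act1 S2 q p = a%:C + b%:C * slope a b.
    by rewrite /act1 /q /p /a /b; apply: complex_eqP; rewrite !ReImE /=; ring.
  by apply: complex_eqP; rewrite !ReImE /=; field.
have qp : positive_line q p.
  rewrite /positive_line (_ : complex.Im _ = 1) ?ltr01 // -D1.
  by rewrite /q /p !ReImE /=; ring.
(* The invariance of [Im (p / q)] gives the real part of the second coordinate;
   the imaginary part only contributes a phase. *)
have p2E : exists y, act2 S2 q p = (- b^-1) +i* y.
  exists (complex.Im (act2 S2 q p)); apply: complex_eqP => //=.
  have : complex.Im (act2 S2 q p * (act1 S2 q p)^*) = 1.
    have -> : complex.Im (act2 S2 q p * (act1 S2 q p)^*) =
      (S1 0 0 * S1 1 1 - S1 0 1 * S1 1 0) * (S2 0 0 * S2 1 1 - S2 0 1 * S2 1 0).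
      by rewrite /act1 /act2 /q /p !ReImE /=; ring.
    by rewrite D1 D2 mulr1.
  rewrite q2E !ReImE /= mulr0 addr0 mulrN => h1.
  apply: (mulIf b0); rewrite mulNr mulVf //.
  by apply/eqP; rewrite -eqr_oppLR h1.
have [y {}p2E] := p2E.
have invIb : (0 +i* b : R[i])^-1 = 0 +i* (- b^-1).
  have Ib0 : (0 +i* b : R[i]) != 0 by apply/eqP => -[] /eqP; rewrite (negbTE b0).
  apply: (mulfI Ib0); rewrite divff //.
  by apply: complex_eqP; rewrite !ReImE /=; field.
have im1 : complex.Im (slope a b / 1) = 1 by rewrite divr1.
have im2 : complex.Im (((- b^-1) +i* y) / (0 +i* b)) = b ^- 2.
  by rewrite invIb !ReImE /=; field.
have B0 : 0 < beta + pi * b ^- 2 by rewrite addr_gt0 // mulr_gt0 // invr_gt0.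
pose G1 := gint (2 * pi : R); pose G2 := gint (2 * (pi * b ^- 2)).
pose G3 := gint (beta + pi * b ^- 2).
have G10 : 0 < G1 by rewrite gint_gt0 // mulr_gt0.
have G20 : 0 < G2 by rewrite gint_gt0 // mulr_gt0 // mulr_gt0 // invr_gt0.
have G30 : 0 < G3 by rewrite gint_gt0.
exists (Num.sqrt (G1 / G2) * (2 * C2 * G3)) => t.
pose s := - t / (2 * pi).
have tE : t = - (2 * pi * s).
  by rewrite /s; move: pi0; move: (pi : R) => P P0; field; rewrite gt_eqF.
pose ch1 := chirp 1 (slope a b) s%:C.
pose ch2 := chirp (0 +i* b) ((- b^-1) +i* y) s%:C.
have pos1 := positive_line_act dS1 qp; have pos2 := positive_line_act dS2 qp.
have := chirp_transfer s%:C m1 m2 dS1 dS2 qp lf.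
cbv zeta; move: pos1 pos2; rewrite q1E p1E q2E p2E -/ch1 -/ch2 => pos1 pos2.
rewrite (L2dot_chirp s%:C pos1 : L2dot ch1 ch1 = _).
rewrite (L2dot_chirp s%:C pos2 : L2dot ch2 ch2 = _) im1 im2.
have -> : complex.Im (s%:C / 1) = 0 by rewrite divr1.
have -> : complex.Im (s%:C / (0 +i* b)) = - (s / b).
  by rewrite invIb !ReImE /=; field.
rewrite mulr0 expr0n mul0r expR0 mul1r mulr1 !normc_real -/G1 -/G2.
rewrite !gtr0_norm //; last by rewrite mulr_gt0 // expR_gt0.
have mch1 : cmeasurable ch1 by exact: cmeasurable_chirp.
have mch2 : cmeasurable ch2 by exact: cmeasurable_chirp.
have rfl (u : R -> R[i]) : {ae mu, forall x, u x = u x} by exact: aeW.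
rewrite (L2dot_ae (cLfun2_measurable lTf1) mch1 gb.1 mch1 Tg (rfl _)).
rewrite (L2dot_ae (cLfun2_measurable lTf2) mch2 hb.1 mch2 Th (rfl _)).
have L1 : L2dot g ch1 = laplace (fun x => g x *
    cexp (- (pi +i* (- (pi * (a / b)))) * (x ^+ 2)%:C)) (0 +i* t).
  apply: eq_cintegral => x.
  apply: (etrans (congr1 (fun z => g x * z) (chirp_slopeE a b s x))).
  by rewrite -tE mulrA.
have L2 : normc (L2dot h ch2) <= 2 * C2 * G3 *
    expR ((2 * pi * (s / b)) ^+ 2 / (4 * (beta + pi * b ^- 2))).
  apply: le_trans (normc_cintegral_le (g := fun x => C2 *
    expR (- (beta + pi * b ^- 2) * x ^+ 2 + 2 * pi * (s / b) * x)) _ _ _) _.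
  - by apply: cmeasurableM; [exact: hb.1|exact: cmeasurableJ].
  - move=> x; rewrite normcM normcJ normc_chirp im2.
    have -> : complex.Im (s%:C / (0 +i* b)) = - (s / b).
      by rewrite invIb !ReImE /=; field.
    apply: le_trans (ler_wpM2r (expR_ge0 _) (hb.2 x)) _.
    rewrite -[leLHS]mulrA -expRD ler_wpM2l // ler_expR le_eqVlt.
    by apply/orP; left; apply/eqP; ring.
  - by apply: integrableRZ; exact: integrable_gauss_exp.
  rewrite RintegralZl ?integrable_gauss_exp // Rintegral_gauss_exp //.
  by rewrite -/G3 le_eqVlt; apply/orP; left; apply/eqP; ring.
rewrite -L1 => key.
rewrite -ler_sqr ?nnegrE ?normc_ge0 //; last first.
  by rewrite !mulr_ge0 ?expR_ge0 ?sqrtr_ge0 // ltW.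
have E20 : 0 < expR ((4 * pi * - (s / b)) ^+ 2 / (8 * (pi * b ^- 2))) * G2.
  by rewrite mulr_gt0 // expR_gt0.
rewrite -(ler_pM2r E20) key.
apply: le_trans (_ : (2 * C2 * G3 *
   expR ((2 * pi * (s / b)) ^+ 2 / (4 * (beta + pi * b ^- 2)))) ^+ 2 * G1 <= _).
  rewrite ler_wpM2r ?(ltW G10) // ler_sqr ?nnegrE ?normc_ge0 //.
  by rewrite !mulr_ge0 ?expR_ge0 // ltW.
set e1 := _ / (4 * _); set e2 := _ / (8 * _); set e3 := - (_ * _).
(* The rate of the transferred bound: the square in [e1] is completed against
   the norm of the second chirp in [e2]. *)
have eE : 2 * e1 = 2 * e3 + e2.
  rewrite /e1 /e2 /e3 tE.
  have bb0 : beta * b ^+ 2 + pi != 0.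
    by rewrite gt_eqF // addr_gt0 // mulr_gt0.
  move: bb0 pi0; move: (pi : R) => P bb0 P0.
  by field; rewrite b0 bb0 gt_eqF.
have sqE x : expR x ^+ 2 = expR (2 * x) :> R.
  by rewrite expr2 -expRD; congr expR; ring.
rewrite [_ ^+ 2]exprMn sqE eE expRD -sqE -[Num.sqrt _ * _ * _]mulrA.
rewrite [in leRHS]exprMn sqr_sqrtr ?divr_ge0 ?(ltW G10) ?(ltW G20) //.
rewrite le_eqVlt; apply/orP; left; apply/eqP.
by field; rewrite gt_eqF.
Qed.

End main.

(** * Hardy's theorem for a pair of metaplectic operators *)

Unset Implicit Arguments.

Theorem corollary25 (R : realType) (S1 S2 : 'M[R]_2)
    (T1 T2 : (R -> R[i]) -> (R -> R[i])) (f : R -> R[i])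
    (C1 C2 alpha beta : R) :
  let a1 := S1 0 0 in let b1 := S1 0 1 in
  let c1 := S1 1 0 in let d1 := S1 1 1 in
  let a2 := S2 0 0 in let b2 := S2 0 1 in
  Sp2 S1 -> Sp2 S2 ->
  a1 * b2 - a2 * b1 != 0 ->
  metaplectic S1 T1 -> metaplectic S2 T2 ->
  cLfun 2%:E f ->
  0 < C1 -> 0 < C2 -> 0 < alpha -> 0 < beta ->
  {ae @lebesgue_measure R, forall x,
     `|T1 f x| <= (C1 * expR (- alpha * x ^+ 2))%:C} ->
  {ae @lebesgue_measure R, forall xi,
     `|T2 f xi| <= (C2 * expR (- beta * xi ^+ 2))%:C} ->
  (alpha * beta = pi ^+ 2 / (a1 * b2 - a2 * b1) ^+ 2 ->
     exists A : R[i], {ae @lebesgue_measure R, forall x,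
       T1 f x = A * cexp (- (alpha +i*
         (pi * ((a2 * d1 - b2 * c1) / (a1 * b2 - a2 * b1)))) * (x ^+ 2)%:C)}) /\
  (alpha * beta > pi ^+ 2 / (a1 * b2 - a2 * b1) ^+ 2 ->
     {ae @lebesgue_measure R, forall x, f x = 0}).
Proof.
move=> a1 b1 c1 d1 a2 b2 dS1 dS2 b0 m1 m2 lf C10 C20 alpha0 beta0 bnd1 bnd2.
have uT1 := metaplectic_unitary m1; have uT2 := metaplectic_unitary m2.
have [g [gb Tg]] := truncation (cLfun2_measurable (unitaryL2_stable uT1 lf))
  bnd1 (ltW C10).
have [h [hb Th]] := truncation (cLfun2_measurable (unitaryL2_stable uT2 lf))
  bnd2 (ltW C20).
have [K hK] := transfer_bound dS1 dS2 b0 m1 m2 lf alpha0 beta0 gb Tg hb Th.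
move: hK; rewrite -/a1 -/b1 -/c1 -/d1 -/a2 -/b2.
set a := a2 * d1 - b2 * c1; set b := a1 * b2 - a2 * b1.
rewrite -/b in b0 *.
have b2p : 0 < b ^+ 2 by rewrite exprn_even_gt0.
have pi0 : 0 < (pi : R) := pi_gt0 R.
pose m (x : R) : R[i] := cexp (- (pi +i* (- (pi * (a / b)))) * (x ^+ 2)%:C).
pose u x := g x * m x.
rewrite -/m => hK; have {}hK : forall t, normc (laplace u (0 +i* t)) <=
  K * expR (- (beta * b ^+ 2 / (4 * pi * (beta * b ^+ 2 + pi)) * t ^+ 2)) := hK.
have ap0 : 0 < alpha + pi by rewrite addr_gt0.
have mm : cmeasurable m by exact: cmeasurable_cgauss.
have nm x : normc (m x) = expR (- pi * x ^+ 2).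
  by rewrite normc_cexp !ReImE /=; congr expR; ring.
have ub : gdominated C1 (alpha + pi) u.
  split; first exact: cmeasurableM gb.1 mm.
  move=> x; rewrite normcM nm (le_trans (ler_wpM2r (expR_ge0 _) (gb.2 x))) //.
  by rewrite -mulrA -expRD ler_wpM2l ?(ltW C10) // ler_expR; lra.
have [S [T fT]] := metaplectic_free m1.
(* The rate of decay found by [transfer_bound] exceeds the critical rate for
   [u] by a term that has the sign of [alpha beta b^2 - pi^2]. *)
have rate : beta * b ^+ 2 / (4 * pi * (beta * b ^+ 2 + pi)) =
    (4 * (alpha + pi))^-1 + (alpha * beta * b ^+ 2 - pi ^+ 2) /
      (4 * pi * (beta * b ^+ 2 + pi) * (alpha + pi)).
  have bb0 : beta * b ^+ 2 + pi != 0.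
    by rewrite gt_eqF // addr_gt0 // mulr_gt0.
  move: bb0 pi0 ap0; move: (pi : R) => P bb0 P0 aP0.
  by field; rewrite bb0 !gt_eqF.
have den0 : 0 < 4 * pi * (beta * b ^+ 2 + pi) * (alpha + pi).
  by rewrite !mulr_gt0 // addr_gt0 // mulr_gt0.
split => [crit|super].
  have crit0 : alpha * beta * b ^+ 2 - pi ^+ 2 = 0.
    by rewrite crit divfK ?subrr // gt_eqF.
  have hK' t : normc (laplace u (0 +i* t)) <=
      K * expR (- (t ^+ 2 / (4 * (alpha + pi)))).
    by apply: le_trans (hK t) _; rewrite rate crit0 mul0r addr0 [_^-1 * _]mulrC.
  have v0 := hardy ap0 ub hK'; set A := _ / _ in v0; exists A.
  have vb := gdominatedB A ub (gdominated_cgauss_real ap0).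
  have := fourier_injective fT ap0 vb (fun t => v0 _).
  apply: ae_imp2 Tg => x -> /subr0_eq; rewrite /u => gE.
  apply: (mulIf (cexp_neq0 (- (pi +i* (- (pi * (a / b)))) * (x ^+ 2)%:C))).
  rewrite [LHS]gE -[RHS]mulrA; congr (_ * _); rewrite /cgauss -cexpD; congr cexp.
  by apply: complex_eqP; rewrite !ReImE /=; ring.
have rate_lt : (4 * (alpha + pi))^-1 <
    beta * b ^+ 2 / (4 * pi * (beta * b ^+ 2 + pi)).
  rewrite rate ltrDl divr_gt0 // subr_gt0.
  by move: super; rewrite ltr_pdivrMr.
have u0 := hardy_supercritical ap0 ub rate_lt hK.
apply/(unitary_null uT1 lf).
have := fourier_injective fT ap0 ub (fun t => u0 _).
apply: ae_imp2 Tg => x -> /eqP; rewrite mulf_eq0 => /orP[/eqP //|].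
by rewrite (negbTE (cexp_neq0 _)).
Qed.
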